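(* Let $\vdash$ be an axiomatic extension of $\mathsf{ILL}$ and $\Phi=\varphi_1\land y\le z\,\&\cdots\&\,\varphi_m\land y\le z\Longrightarrow y\le z$ a Sahlqvist quasiequation compatible with $\vdash$. Then the formula $(1\land\boldsymbol{\varphi_1}^1)\lor\cdots\lor(1\land\boldsymbol{\varphi_m}^1)$ is a theorem of $\vdash$ if and only if $\mathsf{Spec}(\boldsymbol{A})\vDash\mathsf{tr}(\Phi)$ for every $\boldsymbol{A}\in\mathsf{K}_\vdash$.
   Context: A commutative FL-algebra is $\langle A;\land,\lor,\cdot,\to,0,1\rangle$ with $\langle A;\cdot,1\rangle$ a commutative monoid, $\langle A;\land,\lor\rangle$ a lattice, and $a\cdot b\le c\iff a\le b\to c$; $\mathsf{FL}_e$ is their variety. $\mathsf{ILL}$: $\Gamma\vdash\varphi$ iff for some finite $\Sigma\subseteq\Gamma$, $\mathsf{FL}_e\vDash\&_{\gamma\in\Sigma}\gamma\ge1\Longrightarrow\varphi\ge1$. An axiomatic extension $\vdash$ of $\mathsf{ILL}$ adds a substitution-closed set of axioms; $\mathsf{K}_\vdash$ is the variety of commutative FL-algebras satisfying $\varphi\ge1$ for all theorems $\varphi$ of $\vdash$. For $\boldsymbol{A}\in\mathsf{K}_\vdash$, $\mathsf{Spec}(\boldsymbol{A})$ is the poset of meet irreducible congruences of $\boldsymbol{A}$. Powers $a^1=a$, $a^{j+1}=a^j\cdot a$; $\bot=1\land(1\to0)\land(0\to1)\land(1\to(1\to1))\land((1\to1)\to1)$, $\lnot\varphi=\varphi\to\bot$.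 Metalogical properties (finite sets throughout; $\Gamma$ inconsistent if it derives every formula): inconsistency lemma (IL): sets $\sim_n(x_1..x_n)$ with $\Gamma\cup\{\varphi_1..\varphi_n\}$ inconsistent iff $\Gamma\vdash\sim_n(\vec\varphi)$; deduction theorem (DT): sets $(\vec x)\Rightarrow_{nm}(\vec y)$ with $\Gamma,\vec\varphi\vdash\vec\psi$ iff $\Gamma\vdash(\vec\varphi)\Rightarrow_{nm}(\vec\psi)$; proof by cases (PC): sets $(\vec x)\curlyvee_{nm}(\vec y)$ with [$\Gamma,\vec\varphi\vdash\gamma$ and $\Gamma,\vec\psi\vdash\gamma$] iff $\Gamma,(\vec\varphi)\curlyvee_{nm}(\vec\psi)\vdash\gamma$. For axiomatic extensions of $\mathsf{ILL}$ the witnessing sets used are: PC (always holds) $(x_1..x_n)\curlyvee_{nm}(y_1..y_m)=\{(1\land x_1\land\cdots\land x_n)\lor(1\land y_1\land\cdots\land y_m)\}$; DT (when it holds, which is when $(1\land x)^{d}\to(1\land x)^{d+1}$ is a theorem for some $d\ge1$) $\{(1\land x_1\land\cdots\land x_n)^d\to(y_1\land\cdots\land y_m)\}$; IL (when it holds) $\{\lnot(1\land x_1\land\cdots\land x_n)^k\}$ for the $k$ such that $\bot^k\to x$ and $(1\land\lnot(x\land1)^j)^{f(j)}\to\lnot(1\land x)^k$ ($j\ge1$) are theorems for some $f$. Fix a theorem $\top(x)$ of $\vdash$. A formula over $\land,\lor,\to,\lnot,0,1$ is compatible with $\vdash$ if $\vdash$ has IL when $0$ or $\lnot$ occurs, DT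 when $\to$ occurs, PC when $\lor$ occurs. For compatible $\varphi$, $\boldsymbol{\varphi}^1$ is the finite set defined by: $\boldsymbol{x_j}^1=\{x_j\}$; $\boldsymbol{1}^1=\{\top(x_1)\}$; $\boldsymbol{0}^1=\{x_1\}\cup\sim_1(x_1)$; $(\boldsymbol{\psi\land\chi})^1=\boldsymbol{\psi}^1\cup\boldsymbol{\chi}^1$; with $\boldsymbol{\psi}^1=\{\psi_1..\psi_p\}$, $\boldsymbol{\chi}^1=\{\chi_1..\chi_t\}$: $(\boldsymbol{\lnot\psi})^1=\sim_p(\vec\psi)$, $(\boldsymbol{\psi\to\chi})^1=(\vec\psi)\Rightarrow_{pt}(\vec\chi)$, $(\boldsymbol{\psi\lor\chi})^1=(\vec\psi)\curlyvee_{pt}(\vec\chi)$; in the claim $\boldsymbol{\varphi}^1$ stands for the conjunction of its members. Sahlqvist quasiequation: a variable occurrence is positive (negative) if the number of negations and implication antecedents in whose scope it lies is even (odd); positive/negative formulas have all occurrences so; Sahlqvist antecedents are built from variables, negative formulas, $0,1$ by $\land,\lor$; Sahlqvist implications are positive formulas, $\lnot\varphi$, or $\varphi\to\psi$ with $\varphi$ a Sahlqvist antecedent and $\psi$ positive; in $\Phi$, $y,z$ are distinct variables not in the $\varphi_i$, each $\varphi_i$ is built from Sahlqvist implications by $\land,\lor$, and $a\le b$ means $a\land b\approx a$; $\Phi$ is compatible if all $\varphi_i$ are. $\mathsf{tr}(\Phi)$ is the effectively computable first-order sentence in the language of posets such that for every poset $\mathbb{X}$, $\mathsf{Up}(\mathbb{X})\vDash\Phi$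 iff $\mathbb{X}\vDash\mathsf{tr}(\Phi)$, where $\mathsf{Up}(\mathbb{X})$ is the Heyting algebra of upsets ($\cap,\cup$, $U\to V=X\smallsetminus{\downarrow}(U\smallsetminus V)$, $\emptyset$, $X$). *)

(* Defs.v *)
From Stdlib Require Import List Arith.
Import ListNotations.

(* Formulas of ILL over  /\, \/, ., ->, 0, 1 ; variable x_(j+1) = Var j *)
Inductive fm : Type :=
| Var : nat -> fm
| And : fm -> fm -> fm
| Or  : fm -> fm -> fm
| Mul : fm -> fm -> fm
| Imp : fm -> fm -> fm
| Zero : fm
| One : fm.

Fixpoint subst (s : nat -> fm) (f : fm) : fm :=
  match f with
  | Var n => s n
  | And a b => And (subst s a) (subst s b)
  | Or a b => Or (subst s a) (subst s b)
  | Mul a b => Mul (subst s a) (subst s b)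
  | Imp a b => Imp (subst s a) (subst s b)
  | Zero => Zero
  | One => One
  end.

Fixpoint fm_occ (n : nat) (f : fm) : Prop :=
  match f with
  | Var m => m = n
  | And a b | Or a b | Mul a b | Imp a b => fm_occ n a \/ fm_occ n b
  | Zero | One => False
  end.

Definition vars_below (n : nat) (f : fm) : Prop := forall i, fm_occ i f -> i < n.

Record FLe : Type := {
  car :> Type;
  meet : car -> car -> car;
  join : car -> car -> car;
  mul  : car -> car -> car;
  imp  : car -> car -> car;
  zero : car;
  one  : car;
  meet_comm : forall a b, meet a b = meet b a;
  meet_assoc : forall a b c, meet a (meet b c) = meet (meet a b) c;
  join_comm : forall a b, join a b = join b a;
  join_assoc : forall a b c, join a (join b c) = join (join a b) c;
  meet_absorb : forall a b, meet a (join a b) = a;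
  join_absorb : forall a b, join a (meet a b) = a;
  mul_assoc : forall a b c, mul a (mul b c) = mul (mul a b) c;
  mul_comm : forall a b, mul a b = mul b a;
  mul_one : forall a, mul a one = a;
  residuation : forall a b c,
    meet (mul a b) c = mul a b <-> meet a (imp b c) = a
}.

Arguments meet {_}. Arguments join {_}. Arguments mul {_}.
Arguments imp {_}. Arguments zero {_}. Arguments one {_}.

Definition leq {A : FLe} (a b : A) : Prop := meet a b = a.

Fixpoint eval {A : FLe} (v : nat -> A) (f : fm) : A :=
  match f with
  | Var n => v n
  | And a b => meet (eval v a) (eval v b)
  | Or a b => join (eval v a) (eval v b)
  | Mul a b => mul (eval v a) (eval v b)
  | Imp a b => imp (eval v a) (eval v b)
  | Zero => zero
  | One => one
  end.

Definition ILL (G : fm -> Prop) (phi : fm) : Prop :=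
  exists S : list fm, (forall g, In g S -> G g) /\
    forall (A : FLe) (v : nat -> A),
      (forall g, In g S -> leq one (eval v g)) -> leq one (eval v phi).

(* an axiomatic extension is given by a substitution-closed set of axioms *)
Definition axiomatic_ext (Ax : fm -> Prop) : Prop :=
  forall (s : nat -> fm) f, Ax f -> Ax (subst s f).

Definition ext (Ax : fm -> Prop) (G : fm -> Prop) (phi : fm) : Prop :=
  ILL (fun g => G g \/ Ax g) phi.

Definition thm (Ax : fm -> Prop) (phi : fm) : Prop := ext Ax (fun _ => False) phi.

Definition ders (Ax : fm -> Prop) (G : list fm) (phi : fm) : Prop :=
  ext Ax (fun g => In g G) phi.

Definition inK (Ax : fm -> Prop) (A : FLe) : Prop :=
  forall phi, thm Ax phi -> forall v : nat -> A, leq one (eval v phi).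

Definition inst (l : list fm) (f : fm) : fm := subst (fun i => nth i l (Var i)) f.

(* inconsistency lemma: ~_n(x_1..x_n) uses the variables Var 0 .. Var (n-1) *)
Definition IL (Ax : fm -> Prop) : Prop :=
  exists sim : nat -> list fm,
    (forall n f, In f (sim n) -> vars_below n f) /\
    forall n (G phis : list fm), length phis = n ->
      ((forall psi, ders Ax (G ++ phis) psi) <->
       (forall s, In s (sim n) -> ders Ax G (inst phis s))).

(* deduction theorem: (x_1..x_n) =>_nm (y_1..y_m), the x's are Var 0..Var (n-1),
   the y's are Var n .. Var (n+m-1) *)
Definition DT (Ax : fm -> Prop) : Prop :=
  exists dimp : nat -> nat -> list fm,
    (forall n m f, In f (dimp n m) -> vars_below (n + m) f) /\
    forall n m (G phis psis : list fm), length phis = n -> length psis = m ->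
      ((forall psi, In psi psis -> ders Ax (G ++ phis) psi) <->
       (forall s, In s (dimp n m) -> ders Ax G (inst (phis ++ psis) s))).

Definition PC (Ax : fm -> Prop) : Prop :=
  exists pc : nat -> nat -> list fm,
    (forall n m f, In f (pc n m) -> vars_below (n + m) f) /\
    forall n m (G phis psis : list fm) (g : fm), length phis = n -> length psis = m ->
      ((ders Ax (G ++ phis) g /\ ders Ax (G ++ psis) g) <->
       ders Ax (G ++ map (inst (phis ++ psis)) (pc n m)) g).

(* a^1 = a, a^(j+1) = a^j . a  (only used for exponents >= 1) *)
Fixpoint pw (a : fm) (n : nat) : fm :=
  match n with
  | 0 => One
  | S 0 => a
  | S m => Mul (pw a m) a
  end.

Definition fbot : fm :=
  And (And (And (And One (Imp One Zero)) (Imp Zero One)) (Imp One (Imp One One)))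
      (Imp (Imp One One) One).

Definition fneg (a : fm) : fm := Imp a fbot.

Definition oneconj (l : list fm) : fm := fold_left And l One.

(* a_1 /\ ... /\ a_n  (for nonempty lists) *)
Definition conjL (l : list fm) : fm :=
  match l with nil => One | a :: l' => fold_left And l' a end.

(* a_1 \/ ... \/ a_n  (for nonempty lists) *)
Definition disjL (l : list fm) : fm :=
  match l with nil => Zero | a :: l' => fold_left Or l' a end.

Definition x1 : fm := Var 0.

(* the DT parameter d : (1 /\ x)^d -> (1 /\ x)^(d+1) is a theorem *)
Definition dcond (Ax : fm -> Prop) (d : nat) : Prop :=
  1 <= d /\ thm Ax (Imp (pw (And One x1) d) (pw (And One x1) (S d))).

(* the IL parameter k *)
Definition kcond (Ax : fm -> Prop) (k : nat) : Prop :=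
  1 <= k /\ thm Ax (Imp (pw fbot k) x1) /\
  exists f : nat -> nat, forall j, 1 <= j ->
    1 <= f j /\
    thm Ax (Imp (pw (And One (fneg (pw (And x1 One) j))) (f j))
                (fneg (pw (And One x1) k))).

Inductive sfm : Type :=
| SVar : nat -> sfm
| SAnd : sfm -> sfm -> sfm
| SOr  : sfm -> sfm -> sfm
| SImp : sfm -> sfm -> sfm
| SNeg : sfm -> sfm
| SZero : sfm
| SOne : sfm.

Fixpoint has_occ (f : sfm) (n : nat) (odd : bool) : Prop :=
  match f with
  | SVar m => m = n /\ odd = false
  | SZero | SOne => False
  | SAnd a b | SOr a b => has_occ a n odd \/ has_occ b n odd
  | SImp a b => has_occ a n (negb odd) \/ has_occ b n odd
  | SNeg a => has_occ a n (negb odd)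
  end.

Definition occurs (n : nat) (f : sfm) : Prop := has_occ f n true \/ has_occ f n false.
Definition positive (f : sfm) : Prop := forall n, ~ has_occ f n true.
Definition negative (f : sfm) : Prop := forall n, ~ has_occ f n false.

Inductive sahl_ant : sfm -> Prop :=
| sa_var : forall n, sahl_ant (SVar n)
| sa_neg : forall f, negative f -> sahl_ant f
| sa_zero : sahl_ant SZero
| sa_one : sahl_ant SOne
| sa_and : forall a b, sahl_ant a -> sahl_ant b -> sahl_ant (SAnd a b)
| sa_or : forall a b, sahl_ant a -> sahl_ant b -> sahl_ant (SOr a b).

Inductive sahl_imp : sfm -> Prop :=
| si_pos : forall f, positive f -> sahl_imp f
| si_neg : forall a, sahl_ant a -> sahl_imp (SNeg a)
| si_imp : forall a b, sahl_ant a -> positive b -> sahl_imp (SImp a b).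

Inductive sahl_fm : sfm -> Prop :=
| sf_imp : forall f, sahl_imp f -> sahl_fm f
| sf_and : forall a b, sahl_fm a -> sahl_fm b -> sahl_fm (SAnd a b)
| sf_or : forall a b, sahl_fm a -> sahl_fm b -> sahl_fm (SOr a b).

(* Phi = phi_1 /\ y <= z & ... & phi_m /\ y <= z ==> y <= z  is represented by
   the list [phi_1; ...; phi_m] and the variables y, z *)
Definition sahlqvist_qe (phis : list sfm) (y z : nat) : Prop :=
  phis <> nil /\ y <> z /\
  forall phi, In phi phis -> sahl_fm phi /\ ~ occurs y phi /\ ~ occurs z phi.

Fixpoint has_zero_or_neg (f : sfm) : Prop :=
  match f with
  | SVar _ | SOne => False
  | SZero | SNeg _ => True
  | SAnd a b | SOr a b | SImp a b => has_zero_or_neg a \/ has_zero_or_neg b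
  end.

Fixpoint has_imp (f : sfm) : Prop :=
  match f with
  | SVar _ | SOne | SZero => False
  | SImp _ _ => True
  | SNeg a => has_imp a
  | SAnd a b | SOr a b => has_imp a \/ has_imp b
  end.

Fixpoint has_or (f : sfm) : Prop :=
  match f with
  | SVar _ | SOne | SZero => False
  | SOr _ _ => True
  | SNeg a => has_or a
  | SAnd a b | SImp a b => has_or a \/ has_or b
  end.

Definition compatible (Ax : fm -> Prop) (f : sfm) : Prop :=
  (has_zero_or_neg f -> IL Ax) /\ (has_imp f -> DT Ax) /\ (has_or f -> PC Ax).

Definition compatible_qe (Ax : fm -> Prop) (phis : list sfm) : Prop :=
  forall phi, In phi phis -> compatible Ax phi.

(* the translation phi^1, with the witnessing sets for IL (parameter k),
   DT (parameter d) and PC, and the fixed theorem top(x) *)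
Fixpoint phi1 (top : fm) (k d : nat) (f : sfm) : list fm :=
  match f with
  | SVar j => [Var j]
  | SOne => [subst (fun _ => x1) top]
  | SZero => [x1; fneg (pw (oneconj [x1]) k)]
  | SAnd a b => phi1 top k d a ++ phi1 top k d b
  | SNeg a => [fneg (pw (oneconj (phi1 top k d a)) k)]
  | SImp a b => [Imp (pw (oneconj (phi1 top k d a)) d) (conjL (phi1 top k d b))]
  | SOr a b => [Or (oneconj (phi1 top k d a)) (oneconj (phi1 top k d b))]
  end.

Definition target (top : fm) (k d : nat) (phis : list sfm) : fm :=
  disjL (map (fun phi => And One (conjL (phi1 top k d phi))) phis).

Definition partial_order {X : Type} (R : X -> X -> Prop) : Prop :=
  (forall x, R x x) /\ (forall x y, R x y -> R y x -> x = y) /\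
  (forall x y z, R x y -> R y z -> R x z).

Definition upset {X : Type} (R : X -> X -> Prop) (U : X -> Prop) : Prop :=
  forall x y, R x y -> U x -> U y.

(* U -> V = X \ down(U \ V) *)
Definition up_imp {X : Type} (R : X -> X -> Prop) (U V : X -> Prop) : X -> Prop :=
  fun x => ~ exists y, R x y /\ U y /\ ~ V y.

Fixpoint up_eval {X : Type} (R : X -> X -> Prop) (v : nat -> X -> Prop) (f : sfm)
  : X -> Prop :=
  match f with
  | SVar n => v n
  | SAnd a b => fun x => up_eval R v a x /\ up_eval R v b x
  | SOr a b => fun x => up_eval R v a x \/ up_eval R v b x
  | SImp a b => up_imp R (up_eval R v a) (up_eval R v b)
  | SNeg a => up_imp R (up_eval R v a) (fun _ => False)
  | SZero => fun _ => False
  | SOne => fun _ => True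
  end.

(* a <= b  means  a /\ b = a  (equality of upsets) *)
Definition up_le {X : Type} (U V : X -> Prop) : Prop := forall x, (U x /\ V x) <-> U x.

Definition up_sat_qe {X : Type} (R : X -> X -> Prop) (phis : list sfm) (y z : nat) : Prop :=
  forall v : nat -> X -> Prop, (forall n, upset R (v n)) ->
    (forall phi, In phi phis ->
       up_le (fun x => up_eval R v phi x /\ v y x) (v z)) ->
    up_le (v y) (v z).

(* First-order formulas in the language of posets (de Bruijn variables) *)
Inductive pfo : Type :=
| PLe : nat -> nat -> pfo
| PEq : nat -> nat -> pfo
| PFalse : pfo
| PNot : pfo -> pfo
| PAnd : pfo -> pfo -> pfo
| POr : pfo -> pfo -> pfo
| PImp : pfo -> pfo -> pfo
| PForall : pfo -> pfo
| PExists : pfo -> pfo.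

Fixpoint pfo_wf (n : nat) (f : pfo) : Prop :=
  match f with
  | PLe i j | PEq i j => i < n /\ j < n
  | PFalse => True
  | PNot a => pfo_wf n a
  | PAnd a b | POr a b | PImp a b => pfo_wf n a /\ pfo_wf n b
  | PForall a | PExists a => pfo_wf (S n) a
  end.

Definition sentence (f : pfo) : Prop := pfo_wf 0 f.

Fixpoint psat {X : Type} (R : X -> X -> Prop) (env : list X) (f : pfo) : Prop :=
  match f with
  | PLe i j => match nth_error env i, nth_error env j with
               | Some a, Some b => R a b | _, _ => False end
  | PEq i j => match nth_error env i, nth_error env j with
               | Some a, Some b => a = b | _, _ => False end
  | PFalse => False
  | PNot a => ~ psat R env a
  | PAnd a b => psat R env a /\ psat R env b
  | POr a b => psat R env a \/ psat R env b
  | PImp a b => psat R env a -> psat R env b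
  | PForall a => forall x : X, psat R (x :: env) a
  | PExists a => exists x : X, psat R (x :: env) a
  end.

Definition congruence (A : FLe) (t : A -> A -> Prop) : Prop :=
  (forall a, t a a) /\ (forall a b, t a b -> t b a) /\
  (forall a b c, t a b -> t b c -> t a c) /\
  (forall a b c e, t a b -> t c e ->
     t (meet a c) (meet b e) /\ t (join a c) (join b e) /\
     t (mul a c) (mul b e) /\ t (imp a c) (imp b e)).

Definition rel_eq {A : Type} (r s : A -> A -> Prop) : Prop := forall a b, r a b <-> s a b.

Definition meet_irreducible (A : FLe) (t : A -> A -> Prop) : Prop :=
  ~ (forall a b : A, t a b) /\
  forall al be : A -> A -> Prop, congruence A al -> congruence A be ->
    rel_eq t (fun a b => al a b /\ be a b) -> rel_eq t al \/ rel_eq t be.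

Definition Spec (A : FLe) : Type :=
  { t : A -> A -> Prop | congruence A t /\ meet_irreducible A t }.

Definition Spec_le (A : FLe) (s t : Spec A) : Prop :=
  forall a b, proj1_sig s a b -> proj1_sig t a b.

(* Main.v *)
(** Sending [a] to the set of meet irreducible congruences that identify [1 /\ a]
    with [1] turns the spectrum into the space of prime deductive filters of [A],
    and the conditions on [k] and [d] say exactly that the connectives of the
    translation [phi1] act on these clopen upsets as the Heyting operations do.
    Hence the target formula is valid in [A] iff the disjunction of the [phi_i] is
    valid under all clopen valuations of [Spec A].  If it is refuted at [x] by an
    arbitrary upset valuation, the Sahlqvist shape yields finitely many points
    above [x] whose principal upsets generate a smaller, closed, refuting
    valuation; by compactness (Esakia's lemma) positive and negative formulas are
    approximated by clopen valuations above the closed one, which gives a clopen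
    refutation.  Completeness with respect to algebras is the Lindenbaum
    construction. *)

Require Import Defs.
From mathcomp.classical Require classical_sets.
From Stdlib Require Import List Arith Lia Classical ClassicalEpsilon.
From Stdlib Require Import FunctionalExtensionality PropExtensionality.
Import ListNotations.

Set Bullet Behavior "Strict Subproofs".

(** * Commutative FL-algebras *)

Section Order.
Context {A : FLe}.
Implicit Types a b c e : A.

Lemma meet_idem a : meet a a = a.
Proof. rewrite <- (join_absorb A a a) at 2. apply meet_absorb. Qed.

Lemma leq_refl a : leq a a.
Proof. apply meet_idem. Qed.

Lemma leq_trans a b c : leq a b -> leq b c -> leq a c.
Proof.
  unfold leq; intros Hab Hbc.
  rewrite <- Hab at 1. now rewrite <- meet_assoc, Hbc.
Qed.

Lemma leq_antisym a b : leq a b -> leq b a -> a = b.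
Proof. unfold leq; intros Hab Hba. now rewrite <- Hab, meet_comm. Qed.

Lemma meet_lel a b : leq (meet a b) a.
Proof. unfold leq. now rewrite (meet_comm _ (meet a b)), meet_assoc, meet_idem. Qed.

Lemma meet_ler a b : leq (meet a b) b.
Proof. rewrite meet_comm. apply meet_lel. Qed.

Lemma leq_meet a b c : leq c a -> leq c b -> leq c (meet a b).
Proof. unfold leq; intros Ha Hb. now rewrite meet_assoc, Ha. Qed.

Lemma leq_join_eq a b : leq a b <-> join a b = b.
Proof.
  split; intros H.
  - rewrite <- H. rewrite join_comm, (meet_comm _ a b). apply join_absorb.
  - unfold leq. rewrite <- H. apply meet_absorb.
Qed.

Lemma leq_joinl a b : leq a (join a b).
Proof. apply meet_absorb. Qed.

Lemma leq_joinr a b : leq b (join a b).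
Proof. rewrite join_comm. apply leq_joinl. Qed.

Lemma join_leq a b c : leq a c -> leq b c -> leq (join a b) c.
Proof.
  rewrite !leq_join_eq; intros Ha Hb. now rewrite <- join_assoc, Hb.
Qed.

Lemma leq_imp a b c : leq (mul a b) c <-> leq a (imp b c).
Proof. apply residuation. Qed.

Lemma imp_intro a b c : leq (mul a b) c -> leq a (imp b c).
Proof. apply leq_imp. Qed.

Lemma imp_elim a b c : leq a (imp b c) -> leq (mul a b) c.
Proof. apply leq_imp. Qed.

Lemma one_mul a : mul one a = a.
Proof. rewrite mul_comm. apply mul_one. Qed.

Lemma mul_leq a b c e : leq a b -> leq c e -> leq (mul a c) (mul b e).
Proof.
  assert (Hl : forall a b c, leq a b -> leq (mul a c) (mul b c)).
  { intros a' b' c' H. apply imp_elim. apply leq_trans with b'; [exact H|].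
    apply imp_intro, leq_refl. }
  intros Hab Hce. apply leq_trans with (mul b c); [now apply Hl|].
  rewrite !(mul_comm _ b). now apply Hl.
Qed.

Lemma imp_mul_leq a b : leq (mul (imp a b) a) b.
Proof. apply imp_elim, leq_refl. Qed.

Lemma one_leq_imp a b : leq one (imp a b) <-> leq a b.
Proof. rewrite <- leq_imp. now rewrite one_mul. Qed.

Lemma imp_one_l a : imp one a = a.
Proof.
  apply leq_antisym.
  - rewrite <- (mul_one _ (imp one a)). apply imp_mul_leq.
  - apply imp_intro. rewrite mul_one. apply leq_refl.
Qed.

Lemma imp_leq a b c e : leq b a -> leq c e -> leq (imp a c) (imp b e).
Proof.
  intros Hba Hce. apply imp_intro, leq_trans with c; [|exact Hce].
  apply leq_trans with (mul (imp a c) a); [|apply imp_mul_leq].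
  apply mul_leq; [apply leq_refl|exact Hba].
Qed.

Lemma mul_join a b c : mul a (join b c) = join (mul a b) (mul a c).
Proof.
  apply leq_antisym.
  - rewrite mul_comm. apply imp_elim, join_leq; apply imp_intro; rewrite mul_comm.
    + apply leq_joinl.
    + apply leq_joinr.
  - apply join_leq; apply mul_leq; auto using leq_refl, leq_joinl, leq_joinr.
Qed.

(** * Elements below one and their powers *)

Lemma mul_leq_r a b : leq a one -> leq (mul a b) b.
Proof. intros H. rewrite <- (one_mul b) at 2. apply mul_leq; auto using leq_refl. Qed.

Lemma mul_leq_l a b : leq b one -> leq (mul a b) a.
Proof. intros H. rewrite mul_comm. now apply mul_leq_r. Qed.

Lemma meet_one_id a : leq a one -> meet one a = a.
Proof. intros H. rewrite meet_comm. exact H. Qed.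

Fixpoint apow (a : A) (n : nat) : A :=
  match n with 0 => one | S m => mul (apow a m) a end.

Lemma apow_add a n m : apow a (n + m) = mul (apow a n) (apow a m).
Proof.
  induction m as [|m IH].
  - now rewrite Nat.add_0_r, mul_one.
  - rewrite Nat.add_succ_r; simpl. now rewrite IH, mul_assoc.
Qed.

Lemma apow_leq_one a n : leq a one -> leq (apow a n) one.
Proof.
  intros H; induction n as [|n IH]; simpl.
  - apply leq_refl.
  - apply leq_trans with a; [now apply mul_leq_r|exact H].
Qed.

Lemma apow_antimono a n m : leq a one -> n <= m -> leq (apow a m) (apow a n).
Proof.
  intros H Hnm. replace m with (n + (m - n)) by lia.
  rewrite apow_add. now apply mul_leq_l, apow_leq_one.
Qed.

(** Multiplying the hypothesis by further copies of [a] preserves it. Under [dcond] this replaces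
    arbitrary exponents by the fixed [d]. *)
Lemma apow_stable a d n :
  leq (apow a d) (apow a (S d)) -> leq (apow a d) (apow a (n + d)).
Proof.
  intros H; induction n as [|n IH].
  - apply leq_refl.
  - apply leq_trans with (apow a (S d)); [exact H|].
    simpl. apply mul_leq; [exact IH|apply leq_refl].
Qed.

(** Multiplied out, the power is a join of products of [n + m] factors, each containing [n] copies
    of [a] or [m] copies of [b]; the remaining factors lie below one. The double induction splits
    off the last factor. *)
Lemma apow_join a b n m : leq a one -> leq b one ->
  leq (apow (join a b) (n + m)) (join (apow a n) (apow b m)).
Proof.
  intros Ha Hb. assert (Hab : leq (join a b) one) by now apply join_leq.
  revert m; induction n as [|n IHn]; intros m.
  - apply leq_trans with one; [now apply apow_leq_one|apply leq_joinl].
  - induction m as [|m IHm].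
    + apply leq_trans with one; [now apply apow_leq_one|apply leq_joinr].
    + specialize (IHn (S m)).
      change (S n + S m) with (S (n + S m)).
      (* Both induction hypotheses now bound the same power [p]: [IHn] serves a last factor [a],
         [IHm] a last factor [b]. *)
      replace (S n + m) with (n + S m) in IHm by lia.
      set (p := apow (join a b) (n + S m)) in *.
      simpl apow at 1. fold p. rewrite mul_join. apply join_leq.
      * apply leq_trans with (mul (join (apow a n) (apow b (S m))) a).
        { apply mul_leq; auto using leq_refl. }
        rewrite mul_comm, mul_join. apply join_leq.
        { rewrite mul_comm. apply leq_joinl. }
        apply leq_trans with (apow b (S m)); [now apply mul_leq_r|apply leq_joinr].
      * apply leq_trans with (mul (join (apow a (S n)) (apow b m)) b).
        { apply mul_leq; auto using leq_refl. }
        rewrite mul_comm, mul_join. apply join_leq.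
        { apply leq_trans with (apow a (S n)); [now apply mul_leq_r|apply leq_joinl]. }
        rewrite mul_comm. apply leq_joinr.
Qed.

Lemma eval_pw (v : nat -> A) f n : eval v (pw f n) = apow (eval v f) n.
Proof.
  induction n as [|[|n] IH]; simpl in *.
  - reflexivity.
  - now rewrite one_mul.
  - now rewrite IH.
Qed.

Lemma eval_subst (v : nat -> A) s f :
  eval v (subst s f) = eval (fun n => eval v (s n)) f.
Proof. induction f; simpl; congruence. Qed.

(** * Deductive filters *)

(** Deductive filters: they correspond to congruences through [cfilter] and [fcong]. *)
Definition filter (F : A -> Prop) : Prop :=
  F one /\ (forall a b, F a -> leq a b -> F b) /\
  (forall a b, F a -> F b -> F (mul a b)) /\ (forall a, F a -> F (meet one a)).

(** The join of the parts below one is the disjunction witnessing PC. *)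
Definition prime (F : A -> Prop) : Prop :=
  (exists a, ~ F a) /\
  forall a b, F (join (meet one a) (meet one b)) -> F a \/ F b.

Lemma filter_meet F a b : filter F -> F a -> F b -> F (meet a b).
Proof.
  intros (_ & Hup & Hmul & H1) Ha Hb.
  apply Hup with (mul (meet one a) (meet one b)); [auto|]. apply leq_meet.
  - apply leq_trans with (meet one a); [apply mul_leq_l, meet_lel|apply meet_ler].
  - apply leq_trans with (meet one b); [apply mul_leq_r, meet_lel|apply meet_ler].
Qed.

Lemma filter_mp F a b : filter F -> F (imp a b) -> F a -> F b.
Proof.
  intros (_ & Hup & Hmul & _) Hab Ha.
  apply Hup with (mul (imp a b) a); [auto|apply imp_mul_leq].
Qed.

Lemma filter_apow F a n : filter F -> F a -> F (apow a n).
Proof.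
  intros HF Ha; induction n as [|n IH]; simpl; [apply HF|].
  now apply HF.
Qed.

(** The filter generated by [F] and [a]. The exponent varies with [c], as in a local deduction
    theorem. *)
Definition gen (F : A -> Prop) (a : A) : A -> Prop :=
  fun c => exists n, F (imp (apow (meet one a) n) c).

(** Exponents add up under products; closure under meet with one holds because powers of
    [meet one a] lie below one. *)
Lemma gen_filter F a : filter F -> filter (gen F a).
Proof.
  intros HF; assert (HF' := HF); destruct HF' as (H1 & Hup & Hmul & Hm).
  split; [|split; [|split]].
  - exists 0; simpl. now rewrite imp_one_l.
  - intros b c [n Hb] Hbc; exists n. apply Hup with (1 := Hb).
    apply imp_leq; [apply leq_refl|exact Hbc].
  - intros b c [n Hb] [m Hc]; exists (n + m).
    apply Hup with (1 := Hmul _ _ Hb Hc). apply imp_intro. rewrite apow_add.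
    set (p := apow _ n). set (q := apow _ m).
    replace (mul (mul (imp p b) (imp q c)) (mul p q))
      with (mul (mul (imp p b) p) (mul (imp q c) q)).
    + apply mul_leq; apply imp_mul_leq.
    + rewrite !mul_assoc. f_equal.
      rewrite <- !mul_assoc. f_equal. apply mul_comm.
  - intros b [n Hb]; exists n. apply Hup with (1 := Hm _ Hb).
    apply imp_intro, leq_meet.
    + apply leq_trans with (apow (meet one a) n).
      * apply mul_leq_r, meet_lel.
      * apply apow_leq_one, meet_lel.
    + apply imp_elim, meet_ler.
Qed.

Lemma gen_sub F a c : filter F -> F c -> gen F a c.
Proof. intros HF Hc; exists 0; simpl. now rewrite imp_one_l. Qed.

Lemma gen_self F a : filter F -> gen F a a.
Proof.
  intros HF; exists 1. apply HF with one; [apply HF|].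
  apply one_leq_imp; simpl. rewrite one_mul. apply meet_ler.
Qed.

(* Two powers of [a] and [b] bounding [c] are absorbed by a power of the join. *)
Lemma gen_join F a b c : filter F ->
  F (join (meet one a) (meet one b)) -> gen F a c -> gen F b c -> F c.
Proof.
  intros HF Hab [n Hn] [m Hm].
  set (p := meet one a) in *. set (q := meet one b) in *.
  apply filter_mp with (a := join (apow p n) (apow q m)); [exact HF| |].
  - apply HF with (1 := filter_meet _ _ _ HF Hn Hm).
    apply imp_intro. rewrite mul_join. apply join_leq; apply imp_elim.
    + apply meet_lel.
    + apply meet_ler.
  - apply HF with (apow (join p q) (n + m)).
    + now apply filter_apow.
    + apply apow_join; apply meet_lel.
Qed.

(** Zorn's lemma gives a filter maximal among those extending [F] and avoiding [I]. If it contained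
    neither [a] nor [b], the filters generated over it by [a] and by [b] would meet [I] in some [i]
    and [j]. Both would contain the join of [meet one i] and [meet one j], and if the join for [a]
    and [b] were in the filter, [gen_join] would put this element of [I] into it. *)
Lemma prime_filter_extension (F I : A -> Prop) : filter F ->
  (exists i, I i) ->
  (forall i j, I i -> I j -> I (join (meet one i) (meet one j))) ->
  (forall i, I i -> ~ F i) ->
  exists P, filter P /\ prime P /\ (forall a, F a -> P a) /\
    (forall i, I i -> ~ P i).
Proof.
  intros HF HIne HIjoin HFI.
  (* [Zorn_bigcup] also asks about the empty chain, whose union is empty; adjoining [F] turns that
     union into the filter [F]. *)
  pose (adj B := fun a => F a \/ B a).
  pose (good B := filter (adj B) /\ forall i, I i -> ~ adj B i).
  destruct (@classical_sets.Zorn_bigcup A good) as (M & [HM HMI] & Hmax).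
  { intros C HC Htot.
    set (U := classical_sets.bigcup _ _).
    assert (HU : forall a b, adj U a -> adj U b ->
      (F a /\ F b) \/ exists B, C B /\ adj B a /\ adj B b).
    { intros a b [Ha|[B HB Ha]] [Hb|[B' HB' Hb]].
      - now left.
      - right; exists B'; unfold adj; auto.
      - right; exists B; unfold adj; auto.
      - right. destruct (Htot B B' HB HB') as [Hs|Hs]; [exists B'|exists B];
          unfold adj; auto. }
    assert (HU1 : forall B a, C B -> adj B a -> adj U a).
    { intros B a HB [Ha|Ha]; [now left|right]. now exists B. }
    split; [split; [|split; [|split]]|].
    - left. apply HF.
    - intros a b Ha Hab. destruct (HU a a Ha Ha) as [[Fa _]|(B & HB & Ba & _)].
      + left. now apply HF with a.
      + apply HU1 with B; [exact HB|]. destruct (HC B HB) as [HBf _].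
        now apply HBf with a.
    - intros a b Ha Hb. destruct (HU a b Ha Hb) as [[Fa Fb]|(B & HB & Ba & Bb)].
      + left. now apply HF.
      + apply HU1 with B; [exact HB|]. destruct (HC B HB) as [HBf _].
        now apply HBf.
    - intros a Ha. destruct (HU a a Ha Ha) as [[Fa _]|(B & HB & Ba & _)].
      + left. now apply HF.
      + apply HU1 with B; [exact HB|]. destruct (HC B HB) as [HBf _].
        now apply HBf.
    - intros i Hi Ui. destruct (HU i i Ui Ui) as [[Fi _]|(B & HB & Bi & _)].
      + now apply (HFI i).
      + destruct (HC B HB) as [_ HBI]. now apply (HBI i). }
  assert (Hgen : forall a, ~ adj M a -> exists i, I i /\ gen (adj M) a i).
  { intros a Ha. apply NNPP; intros Hno. apply (Hmax (gen (adj M) a)).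
    - split.
      + intros c Hc. apply gen_sub; [exact HM|now right].
      + intros Hsub. apply Ha. right. now apply Hsub, gen_self.
    - assert (E : adj (gen (adj M) a) = gen (adj M) a).
      { apply functional_extensionality; intros c. apply propositional_extensionality.
        split; [intros [Hc|Hc]; [|exact Hc]|now right].
        apply gen_sub; [exact HM|now left]. }
      unfold good; rewrite E. split; [now apply gen_filter|].
      intros i Hi Hg. apply Hno. now exists i. }
  exists (adj M). split; [exact HM|split; [split|split]].
  - destruct HIne as [i Hi]. exists i. now apply HMI.
  - intros a b Hab. apply NNPP; intros Hno. apply not_or_and in Hno.
    destruct (Hgen a) as (i & Hi & Hai); [tauto|].
    destruct (Hgen b) as (j & Hj & Hbj); [tauto|].
    apply (HMI (join (meet one i) (meet one j))); [now apply HIjoin|].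
    apply gen_join with a b; [exact HM|exact Hab| |].
    + destruct (gen_filter (adj M) a HM) as (_ & Hup & _ & H1).
      apply Hup with (1 := H1 _ Hai). apply leq_joinl.
    + destruct (gen_filter (adj M) b HM) as (_ & Hup & _ & H1).
      apply Hup with (1 := H1 _ Hbj). apply leq_joinr.
  - intros a Ha. now left.
  - exact HMI.
Qed.

Lemma prime_filter_separation (F : A -> Prop) c : filter F -> ~ F c ->
  exists P, filter P /\ prime P /\ (forall a, F a -> P a) /\ ~ P c.
Proof.
  intros HF Hc.
  destruct (prime_filter_extension F (fun i => leq (meet one i) c))
    as (P & HP & HPp & Hsub & HI); auto.
  - exists c. apply meet_ler.
  - intros i j Hi Hj. apply leq_trans with (2 := join_leq _ _ _ Hi Hj). apply meet_ler.
  - intros i Hi Fi. apply Hc. now apply HF with (meet one i); [apply HF|].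
  - exists P. repeat (split; [assumption|]). apply HI, meet_ler.
Qed.

(** * Congruences and the spectrum *)

(** The elements that lie above one in the quotient by [t]. *)
Definition cfilter (t : A -> A -> Prop) : A -> Prop := fun a => t (meet one a) one.

Definition fcong (F : A -> Prop) : A -> A -> Prop :=
  fun a b => F (imp a b) /\ F (imp b a).

Lemma cfilter_filter t : congruence A t -> filter (cfilter t).
Proof.
  intros (Hr & Hs & Ht & Hc). unfold cfilter.
  assert (Hup : forall a b, t (meet one a) one -> leq a b -> t (meet one b) one).
  { intros a b Ha Hab.
    (* Joining both sides of the congruence for [a] with [meet one b] leaves [meet one b] on the
       left and [one] on the right. *)
    assert (E1 : join (meet one a) (meet one b) = meet one b).
    { apply leq_join_eq, leq_meet; [apply meet_lel|].
      apply leq_trans with a; [apply meet_ler|exact Hab]. }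
    assert (E2 : join one (meet one b) = one) by apply join_absorb.
    destruct (Hc _ _ _ _ Ha (Hr (meet one b))) as (_ & Hj & _).
    now rewrite E1, E2 in Hj. }
  split; [|split; [exact Hup|split]].
  - rewrite meet_idem. apply Hr.
  - intros a b Ha Hb.
    apply Hup with (mul (meet one a) (meet one b)).
    + rewrite meet_one_id.
      * destruct (Hc _ _ _ _ Ha Hb) as (_ & _ & H & _). now rewrite mul_one in H.
      * apply leq_trans with (meet one b); [apply mul_leq_r|]; apply meet_lel.
    + apply mul_leq; apply meet_ler.
  - intros a Ha. now rewrite meet_assoc, meet_idem.
Qed.

(** A congruence is thus recovered from its filter, so inclusions of congruences can be tested on
    filters. *)
Lemma cong_cfilter t a b : congruence A t ->
  t a b <-> cfilter t (imp a b) /\ cfilter t (imp b a).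
Proof.
  intros Hcong. assert (HF := cfilter_filter t Hcong).
  destruct Hcong as (Hr & Hs & Ht & Hc). unfold cfilter.
  assert (Himp : forall a b, t a b -> t (meet one (imp a b)) one).
  { intros x y Hxy.
    assert (E : meet one (imp y y) = one) by apply one_leq_imp, leq_refl.
    rewrite <- E at 2. apply Hc; [apply Hr|]. apply Hc; auto. }
  (* With [u] congruent to one, [mul u x] is congruent to [x] and lies below [y], so meeting it with
     [y] changes nothing. *)
  assert (Hmeet : forall a b, t (meet one (imp a b)) one -> t a (meet a b)).
  { intros x y H. set (u := meet one (imp x y)) in *.
    assert (Hu : t (mul u x) x).
    { destruct (Hc _ _ _ _ H (Hr x)) as (_ & _ & Hm & _). now rewrite one_mul in Hm. }
    assert (E : meet (mul u x) y = mul u x).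
    { apply leq_trans with (2 := imp_mul_leq x y).
      apply mul_leq; [apply meet_ler|apply leq_refl]. }
    apply Ht with (mul u x); [now apply Hs|]. rewrite <- E. now apply Hc. }
  split.
  - intros H; split; auto.
  - intros [H1 H2]. apply Ht with (meet a b); [now apply Hmeet|].
    rewrite meet_comm. now apply Hs, Hmeet.
Qed.

Lemma fcong_congruence F : filter F -> congruence A (fcong F).
Proof.
  intros HF; assert (HF' := HF); destruct HF' as (H1 & Hup & Hmul & Hm).
  assert (Hle : forall a b, leq a b -> F (imp a b)).
  { intros a b H. apply Hup with one; [exact H1|now apply one_leq_imp]. }
  assert (Htr : forall a b c, F (imp a b) -> F (imp b c) -> F (imp a c)).
  { intros a b c Hab Hbc. apply Hup with (1 := Hmul _ _ Hbc Hab).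
    apply imp_intro. rewrite <- mul_assoc.
    apply leq_trans with (mul (imp b c) b); [|apply imp_mul_leq].
    apply mul_leq; [apply leq_refl|apply imp_mul_leq]. }
  assert (Hmeet : forall a b c e, F (imp a b) -> F (imp c e) ->
    F (imp (meet a c) (meet b e))).
  { intros a b c e Hab Hce. apply Hup with (1 := filter_meet _ _ _ HF Hab Hce).
    apply imp_intro, leq_meet.
    - apply leq_trans with (2 := imp_mul_leq a b).
      apply mul_leq; apply meet_lel.
    - apply leq_trans with (2 := imp_mul_leq c e).
      apply mul_leq; apply meet_ler. }
  assert (Hjoin : forall a b c e, F (imp a b) -> F (imp c e) ->
    F (imp (join a c) (join b e))).
  { intros a b c e Hab Hce. apply Hup with (1 := filter_meet _ _ _ HF Hab Hce).
    apply imp_intro. rewrite mul_join. apply join_leq.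
    - apply leq_trans with b; [|apply leq_joinl]. apply imp_elim, meet_lel.
    - apply leq_trans with e; [|apply leq_joinr]. apply imp_elim, meet_ler. }
  assert (Hmul2 : forall a b c e, F (imp a b) -> F (imp c e) ->
    F (imp (mul a c) (mul b e))).
  { intros a b c e Hab Hce. apply Hup with (1 := Hmul _ _ Hab Hce). apply imp_intro.
    replace (mul (mul (imp a b) (imp c e)) (mul a c))
      with (mul (mul (imp a b) a) (mul (imp c e) c)).
    - apply mul_leq; apply imp_mul_leq.
    - rewrite !mul_assoc. f_equal. rewrite <- !mul_assoc. f_equal. apply mul_comm. }
  assert (Himp : forall a b c e, F (imp b a) -> F (imp c e) ->
    F (imp (imp a c) (imp b e))).
  { intros a b c e Hba Hce. apply Hup with (1 := Hmul _ _ Hba Hce).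
    apply imp_intro, imp_intro.
    replace (mul (mul (mul (imp b a) (imp c e)) (imp a c)) b)
      with (mul (imp c e) (mul (imp a c) (mul (imp b a) b))).
    - apply leq_trans with (2 := imp_mul_leq c e).
      apply mul_leq; [apply leq_refl|].
      apply leq_trans with (2 := imp_mul_leq a c).
      apply mul_leq; [apply leq_refl|apply imp_mul_leq].
    - rewrite !mul_assoc. f_equal.
      rewrite (mul_comm _ (imp b a) (imp c e)), <- !mul_assoc. f_equal. apply mul_comm. }
  unfold fcong. split; [|split; [|split]].
  - intros a; split; apply Hle, leq_refl.
  - tauto.
  - intros a b c [] []; split; apply Htr with b; assumption.
  - intros a b c e [] []; repeat split; auto.
Qed.

Lemma cfilter_fcong F a : filter F -> cfilter (fcong F) a <-> F a.
Proof.
  intros HF. unfold cfilter, fcong. rewrite imp_one_l. split.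
  - intros [_ H]. now apply HF with (meet one a); [|apply meet_ler].
  - intros H; split; [|now apply HF].
    apply HF with one; [apply HF|apply one_leq_imp, meet_lel].
Qed.

(** * Points of the spectrum as prime filters *)

Definition sat (a : A) (x : Spec A) : Prop := cfilter (proj1_sig x) a.

Lemma sat_filter x : filter (fun a => sat a x).
Proof. apply cfilter_filter. apply (proj2_sig x). Qed.

Lemma sat_up a b x : sat a x -> leq a b -> sat b x.
Proof. intros. now apply (sat_filter x) with a. Qed.

Lemma sat_ge_one a x : leq one a -> sat a x.
Proof. apply sat_up, (sat_filter x). Qed.

Lemma sat_meet a b x : sat (meet a b) x <-> sat a x /\ sat b x.
Proof.
  split.
  - intros H; split; apply sat_up with (1 := H); [apply meet_lel|apply meet_ler].
  - intros [Ha Hb]. exact (filter_meet _ a b (sat_filter x) Ha Hb).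
Qed.

Lemma sat_mp a b x : sat (imp a b) x -> sat a x -> sat b x.
Proof. exact (filter_mp _ a b (sat_filter x)). Qed.

Lemma sat_apow a n x : sat a x -> sat (apow a n) x.
Proof. exact (filter_apow _ a n (sat_filter x)). Qed.

Lemma Spec_le_sat x y : Spec_le A x y <-> forall a, sat a x -> sat a y.
Proof.
  destruct x as [t [Ht Hti]], y as [s [Hs Hsi]]. unfold Spec_le, sat; simpl. split.
  - intros H a. apply H.
  - intros H a b. rewrite (cong_cfilter t a b Ht), (cong_cfilter s a b Hs).
    intros []; split; auto.
Qed.

Lemma Spec_le_partial_order : partial_order (Spec_le A).
Proof.
  split; [|split].
  - intros x a b; auto.
  - intros [t Ht] [s Hs] Hts Hst. unfold Spec_le in *; simpl in *.
    assert (E : t = s).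
    { apply functional_extensionality; intros a.
      apply functional_extensionality; intros b.
      apply propositional_extensionality; split; auto. }
    subst s. f_equal. apply proof_irrelevance.
  - intros x y w Hxy Hyw a b H. auto.
Qed.

Lemma sat_proper x : exists a, ~ sat a x.
Proof.
  destruct x as [t [Ht [Hproper Hirr]]]. unfold sat; simpl.
  apply NNPP; intros Hno. apply Hproper; intros a b.
  apply cong_cfilter; [exact Ht|].
  split; apply NNPP; intros H; apply Hno; eexists; exact H.
Qed.

(** By [gen_join], the congruence is the intersection of those of the filters generated over it by
    [a] and by [b]. Irreducibility makes it equal to one of them. *)
Lemma sat_prime x : prime (fun a => sat a x).
Proof.
  split; [apply sat_proper|].
  destruct x as [t [Ht [Hproper Hirr]]]. unfold sat; simpl. intros a b Hab.
  assert (HF := cfilter_filter t Ht).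
  assert (Ha := gen_filter _ a HF). assert (Hb := gen_filter _ b HF).
  destruct (Hirr (fcong (gen (cfilter t) a)) (fcong (gen (cfilter t) b)))
    as [E|E]; try now apply fcong_congruence.
  - intros c e. rewrite (cong_cfilter t c e Ht). unfold fcong. split.
    + intros []; repeat split; now apply gen_sub.
    + intros [[] []]; split; now apply gen_join with a b.
  - left. apply E. apply (cfilter_fcong _ _ Ha). now apply gen_self.
  - right. apply E. apply (cfilter_fcong _ _ Hb). now apply gen_self.
Qed.

Lemma prime_filter_point P : filter P -> prime P ->
  exists x, forall a, sat a x <-> P a.
Proof.
  intros HP [[c Hc] Hprime]. assert (Hcong := fcong_congruence P HP).
  assert (Hirr : meet_irreducible A (fcong P)).
  { split.
    - intros Hall. apply Hc. apply (cfilter_fcong P c HP). apply Hall.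
    - intros al be Hal Hbe E.
      assert (EF : forall a, P a <-> cfilter al a /\ cfilter be a).
      { intros a. rewrite <- (cfilter_fcong P a HP). apply E. }
      assert (Hal' := cfilter_filter al Hal). assert (Hbe' := cfilter_filter be Hbe).
      (* If both filters had elements [a], [b] outside [P], the join of their parts below one would
         lie in both filters, hence in [P], against primeness. *)
      assert (D : (forall a, cfilter al a -> P a) \/ (forall a, cfilter be a -> P a)).
      { apply NNPP; intros Hno. apply not_or_and in Hno as [Ha Hb].
        apply not_all_ex_not in Ha as [a Ha]. apply not_all_ex_not in Hb as [b Hb].
        apply imply_to_and in Ha as [Ha Ha']. apply imply_to_and in Hb as [Hb Hb'].
        destruct (Hprime a b) as [H|H]; try contradiction.
        apply EF. split.
        - apply Hal' with (meet one a); [now apply Hal'|apply leq_joinl].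
        - apply Hbe' with (meet one b); [now apply Hbe'|apply leq_joinr]. }
      destruct D as [D|D]; [left|right]; intros a b; split.
      + intros H. now apply E in H.
      + intros H. apply (cong_cfilter al) in H; [|exact Hal].
        destruct H; split; now apply D.
      + intros H. now apply E in H.
      + intros H. apply (cong_cfilter be) in H; [|exact Hbe].
        destruct H; split; now apply D. }
  exists (exist _ (fcong P) (conj Hcong Hirr)).
  intros a. exact (cfilter_fcong P a HP).
Qed.

Lemma sat_join_below_one a b x : leq a one -> leq b one ->
  sat (join a b) x <-> sat a x \/ sat b x.
Proof.
  intros Ha Hb. split.
  - intros H. apply sat_prime. now rewrite !meet_one_id.
  - intros [H|H]; apply sat_up with (1 := H); [apply leq_joinl|apply leq_joinr].
Qed.

(** The elements above one form a filter; if [c] were not among them, a prime filter containing them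
    would omit [c]. *)
Lemma leq_one_of_sat c : (forall x, sat c x) -> leq one c.
Proof.
  intros H. apply NNPP; intros Hc.
  destruct (prime_filter_separation (fun a => leq one a) c)
    as (P & HP & HPp & _ & HPc); [|exact Hc|].
  - split; [|split; [|split]].
    + apply leq_refl.
    + intros a b; apply leq_trans.
    + intros a b Ha Hb. rewrite <- (mul_one A one). now apply mul_leq.
    + intros a Ha. now apply leq_meet; [apply leq_refl|].
  - destruct (prime_filter_point P HP HPp) as [x Hx]. apply HPc, Hx, H.
Qed.

(** If [c] were outside the generated filter, a prime filter extending that filter without [c] would
    be a point above [x] satisfying [a] but not [c]. *)
Lemma gen_of_sat x a c :
  (forall z, Spec_le A x z -> sat a z -> sat c z) -> gen (fun e => sat e x) a c.
Proof.
  intros H. assert (HF := sat_filter x). apply NNPP; intros Hc.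
  destruct (prime_filter_separation _ c (gen_filter _ a HF) Hc)
    as (P & HP & HPp & Hsub & HPc).
  destruct (prime_filter_point P HP HPp) as [z Hz]. apply HPc, Hz, H.
  - apply Spec_le_sat; intros e He. now apply Hz, Hsub, gen_sub.
  - now apply Hz, Hsub, gen_self.
Qed.

(** From right to left, [gen_of_sat] yields some exponent [n], and stability puts the power [d] of
    [q] below the power [n], so that [d] serves for every [x] and [r]. *)
Lemma sat_apow_imp x q r d : leq q one -> leq (apow q d) (apow q (S d)) ->
  sat (imp (apow q d) r) x <-> forall z, Spec_le A x z -> sat q z -> sat r z.
Proof.
  intros Hq Hd. split.
  - intros H z Hxz Hz. apply sat_mp with (apow q d).
    + revert H. now apply (proj1 (Spec_le_sat x z)).
    + now apply sat_apow.
  - intros H. destruct (gen_of_sat x q r H) as [n Hn].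
    apply sat_up with (1 := Hn). apply imp_leq; [|apply leq_refl].
    rewrite meet_one_id by exact Hq.
    apply leq_trans with (apow q (n + d)); [now apply apow_stable|].
    apply apow_antimono; [exact Hq|lia].
Qed.

End Order.

(** * Finite sets of formulas, conjunctions and disjunctions at a point *)

Definition satL {A : FLe} (w : nat -> A) (l : list fm) (x : Spec A) : Prop :=
  forall g, In g l -> sat (eval w g) x.

Lemma sat_fold_And {A : FLe} (w : nat -> A) l f x :
  sat (eval w (fold_left And l f)) x <-> sat (eval w f) x /\ satL w l x.
Proof.
  revert f; induction l as [|g l IH]; intros f; simpl.
  - split; [|tauto]. intros H; split; [exact H|intros g []].
  - rewrite IH; simpl. rewrite sat_meet. unfold satL; simpl. split.
    + intros [[Hf Hg] Hl]; split; [exact Hf|]. intros h [<-|Hh]; auto.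
    + intros [Hf Hl]. repeat split; auto.
Qed.

Lemma sat_oneconj {A : FLe} (w : nat -> A) l x :
  sat (eval w (oneconj l)) x <-> satL w l x.
Proof.
  unfold oneconj. rewrite sat_fold_And. split; [tauto|].
  intros H; split; [|exact H]. apply sat_ge_one, leq_refl.
Qed.

Lemma sat_conjL {A : FLe} (w : nat -> A) l x :
  sat (eval w (conjL l)) x <-> satL w l x.
Proof.
  destruct l as [|f l]; simpl.
  - split; [intros _ g []|]. intros _. apply sat_ge_one, leq_refl.
  - rewrite sat_fold_And. unfold satL; simpl. split.
    + intros [Hf Hl] g [<-|Hg]; auto.
    + intros H; split; auto.
Qed.

Lemma oneconj_leq_one {A : FLe} (w : nat -> A) l : leq (eval w (oneconj l)) one.
Proof.
  unfold oneconj.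
  assert (H : forall l f, leq (eval w f) one -> leq (eval w (fold_left And l f)) one).
  { clear; induction l as [|g l IH]; intros f Hf; simpl; [exact Hf|].
    apply IH; simpl. apply leq_trans with (eval w f); [apply meet_lel|exact Hf]. }
  apply H, leq_refl.
Qed.

(** Points are prime, so joins act as unions on elements below one. *)
Lemma sat_disjL {A : FLe} (w : nat -> A) l x : l <> [] ->
  (forall g, In g l -> leq (eval w g) one) ->
  sat (eval w (disjL l)) x <-> exists g, In g l /\ sat (eval w g) x.
Proof.
  assert (H : forall l f, leq (eval w f) one -> (forall g, In g l -> leq (eval w g) one) ->
    sat (eval w (fold_left Or l f)) x <->
    sat (eval w f) x \/ exists g, In g l /\ sat (eval w g) x).
  { clear; induction l as [|g l IH]; intros f Hf Hl; simpl.
    - split; [tauto|]. intros [H|(g & [] & _)]; exact H.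
    - rewrite IH; simpl.
      + rewrite sat_join_below_one by auto using in_eq. split.
        * intros [[H|H]|(h & Hh & H)]; eauto.
        * intros [H|(h & [<-|Hh] & H)]; eauto.
      + apply join_leq; auto using in_eq.
      + auto using in_cons. }
  destruct l as [|f l]; [congruence|]. intros _ Hl; simpl. rewrite H; auto using in_eq, in_cons.
  split.
  - intros [Hf|(g & Hg & Hs)]; eauto.
  - intros (g & [<-|Hg] & Hs); eauto.
Qed.

(** * The translation computes upsets *)

Section Canonicity.
Variables (Ax : fm -> Prop) (top : fm) (k d : nat).
Hypothesis top_thm : thm Ax top.
Variable A : FLe.
Hypothesis A_K : inK Ax A.
Implicit Types (w : nat -> A) (x z : Spec A) (V : nat -> Spec A -> Prop).

(** Compatibility in terms of the exponents: each connective brings only its own parameter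
    condition. *)
Definition admissible (f : sfm) : Prop :=
  (has_zero_or_neg f -> kcond Ax k) /\ (has_imp f -> dcond Ax d).

Lemma thm_imp_leq a b w : thm Ax (Imp a b) -> leq (eval w a) (eval w b).
Proof. intros H. apply one_leq_imp. exact (A_K _ H w). Qed.

(** The power [k] of the constant lies below every element, so a filter containing the constant
    would be improper. *)
Lemma sat_bot w x : kcond Ax k -> ~ sat (eval w fbot) x.
Proof.
  intros (_ & Hbot & _) H. destruct (sat_proper x) as [a Ha]. apply Ha.
  apply sat_up with (apow (eval w fbot) k); [now apply sat_apow|].
  apply (thm_imp_leq _ _ (fun _ => a)) in Hbot. now rewrite eval_pw in Hbot.
Qed.

(** When no point above [x] satisfies [q], some power of [q] implies [fbot] at [x]; the theorems in
    [kcond] exchange this unknown exponent for [k]. *)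
Lemma sat_neg_apow w x (q : A) : kcond Ax k -> leq q one ->
  sat (imp (apow q k) (eval w fbot)) x <-> forall z, Spec_le A x z -> ~ sat q z.
Proof.
  intros Hk Hq. split.
  - intros H z Hxz Hz. apply (sat_bot w z Hk). apply sat_mp with (apow q k).
    + revert H. now apply (proj1 (Spec_le_sat x z)).
    + now apply sat_apow.
  - intros H. destruct (gen_of_sat x q (eval w fbot)) as [n Hn].
    { intros z Hxz Hz. destruct (H z Hxz Hz). }
    rewrite meet_one_id in Hn by exact Hq.
    (* [kcond] speaks of exponents from 1 on, while [n] may be 0. Passing to [S n] is harmless,
       since powers of [q] decrease. *)
    destruct Hk as (_ & _ & f & Hf). destruct (Hf (S n)) as [_ Hthm]; [lia|].
    apply (thm_imp_leq _ _ (fun _ => q)) in Hthm.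
    rewrite eval_pw in Hthm.
    change (leq (apow (meet one (imp (eval (fun _ => q) (pw (And x1 One) (S n)))
                                     (eval w fbot))) (f (S n)))
                (imp (eval (fun _ => q) (pw (And One x1) k)) (eval w fbot))) in Hthm.
    rewrite !eval_pw in Hthm.
    change (eval (fun _ => q) (And x1 One)) with (meet q one) in Hthm.
    change (eval (fun _ => q) (And One x1)) with (meet one q) in Hthm.
    rewrite (meet_comm A q one), (meet_one_id q Hq) in Hthm.
    refine (sat_up _ _ _ _ Hthm). apply sat_apow, sat_meet. split.
    + apply sat_ge_one, leq_refl.
    + apply sat_up with (1 := Hn). apply imp_leq; [|apply leq_refl].
      now apply mul_leq_l.
Qed.

Definition clopen w : nat -> Spec A -> Prop := fun n => sat (w n).

(** Induction on [f]: disjunction uses primeness, implication the exponent [d], negation the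
    exponent [k], and the constant 1 the theorem [top]. *)
Lemma up_eval_phi1 f w x : admissible f ->
  up_eval (Spec_le A) (clopen w) f x <-> satL w (phi1 top k d f) x.
Proof.
  revert x; induction f as [n|a IHa b IHb|a IHa b IHb|a IHa b IHb|a IHa| |];
    intros x [Hk Hd]; simpl in Hk, Hd; unfold satL; simpl.
  - unfold clopen. split.
    + intros H g [<-|[]]; exact H.
    + intros H. exact (H (Var n) (or_introl eq_refl)).
  - rewrite IHa, IHb by (split; tauto). unfold satL. split.
    + intros [Ha Hb] g Hg. apply in_app_or in Hg as []; auto.
    + intros H; split; intros g Hg; apply H, in_or_app; tauto.
  - rewrite IHa, IHb, <- !sat_oneconj by (split; tauto).
    rewrite <- sat_join_below_one by apply oneconj_leq_one. split.
    + intros H g [<-|[]]; exact H.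
    + intros H. apply (H _ (or_introl eq_refl)).
  - destruct (Hd I) as [_ Hthm].
    set (qa := oneconj (phi1 top k d a)). set (qb := conjL (phi1 top k d b)).
    assert (E : sat (eval w (Imp (pw qa d) qb)) x <->
      up_imp (Spec_le A) (up_eval (Spec_le A) (clopen w) a)
        (up_eval (Spec_le A) (clopen w) b) x).
    { simpl. rewrite eval_pw.
      assert (Hq : leq (eval w qa) one) by apply oneconj_leq_one.
      rewrite sat_apow_imp; [|exact Hq|].
      - unfold up_imp. split.
        + intros H (z & Hxz & Ha & Hb). apply Hb, IHb, sat_conjL; [split; tauto|].
          apply H; [exact Hxz|]. apply sat_oneconj, IHa; [split; tauto|exact Ha].
        + intros H z Hxz Ha. apply NNPP; intros Hb. apply H. exists z.
          split; [exact Hxz|split].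
          * apply IHa; [split; tauto|]. now apply sat_oneconj.
          * intros Hb'. apply Hb, sat_conjL, IHb; [split; tauto|exact Hb'].
      - apply (thm_imp_leq _ _ (fun _ => eval w qa)) in Hthm.
        rewrite !eval_pw in Hthm. simpl eval in Hthm.
        now rewrite (meet_one_id _ Hq) in Hthm. }
    rewrite <- E. split.
    + intros H g [<-|[]]; exact H.
    + intros H. apply (H _ (or_introl eq_refl)).
  - set (qa := oneconj (phi1 top k d a)).
    assert (E : sat (eval w (fneg (pw qa k))) x <->
      up_imp (Spec_le A) (up_eval (Spec_le A) (clopen w) a) (fun _ => False) x).
    { change (eval w (fneg (pw qa k))) with (imp (eval w (pw qa k)) (eval w fbot)).
      rewrite eval_pw, sat_neg_apow; [|exact (Hk I)|apply oneconj_leq_one].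
      unfold up_imp. split.
      - intros H (z & Hxz & Ha & _). apply (H z Hxz).
        apply sat_oneconj, IHa; [split; tauto|exact Ha].
      - intros H z Hxz Ha. apply H. exists z. split; [exact Hxz|split; [|tauto]].
        apply IHa; [split; tauto|]. now apply sat_oneconj. }
    rewrite <- E. split.
    + intros H g [<-|[]]; exact H.
    + intros H. apply (H _ (or_introl eq_refl)).
  (* The set for 0 holds a variable and its negation, which cannot be satisfied together at [x]. *)
  - split; [tauto|]. intros H.
    assert (H1 := H _ (or_introl eq_refl)).
    assert (H2 := H _ (or_intror (or_introl eq_refl))).
    change (sat (imp (eval w (pw (oneconj [x1]) k)) (eval w fbot)) x) in H2.
    rewrite eval_pw, sat_neg_apow in H2; [|exact (Hk I)|apply (oneconj_leq_one w [x1])].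
    apply (H2 x); [intros a b Hab; exact Hab|]. apply sat_oneconj. intros g [<-|[]]. exact H1.
  - split; [|tauto]. intros _ g [<-|[]]. apply sat_ge_one.
    rewrite eval_subst. exact (A_K _ top_thm _).
Qed.

Lemma sat_target phis w x : phis <> [] -> (forall f, In f phis -> admissible f) ->
  sat (eval w (target top k d phis)) x <->
  exists f, In f phis /\ up_eval (Spec_le A) (clopen w) f x.
Proof.
  intros Hne Hadm. unfold target. rewrite sat_disjL.
  - split.
    + intros (g & Hg & H). apply in_map_iff in Hg as (f & <- & Hf).
      exists f; split; [exact Hf|]. apply up_eval_phi1; [auto|].
      simpl in H. apply sat_meet in H as [_ H]. now apply sat_conjL.
    + intros (f & Hf & H). eexists; split; [apply in_map, Hf|].
      simpl. apply sat_meet. split; [apply sat_ge_one, leq_refl|].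
      apply sat_conjL. now apply up_eval_phi1; [auto|].
  - intros H. apply map_eq_nil in H. contradiction.
  - intros g Hg. apply in_map_iff in Hg as (f & <- & Hf). apply meet_lel.
Qed.

(** * Canonicity of Sahlqvist formulas *)

Definition sub V V' : Prop := forall n x, V n x -> V' n x.

Lemma up_eval_mono f V V' : sub V V' ->
  (positive f -> forall x, up_eval (Spec_le A) V f x -> up_eval (Spec_le A) V' f x) /\
  (negative f -> forall x, up_eval (Spec_le A) V' f x -> up_eval (Spec_le A) V f x).
Proof.
  intros HV. unfold positive, negative.
  induction f as [n|a IHa b IHb|a IHa b IHb|a IHa b IHb|a IHa| |]; simpl.
  - split; [intros _ x; apply HV|]. intros H. destruct (H n); auto.
  - destruct IHa as [Pa Na], IHb as [Pb Nb]. split; intros H x [Ha Hb]; split.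
    + apply Pa; [intros n Hn; apply (H n)|]; auto.
    + apply Pb; [intros n Hn; apply (H n)|]; auto.
    + apply Na; [intros n Hn; apply (H n)|]; auto.
    + apply Nb; [intros n Hn; apply (H n)|]; auto.
  - destruct IHa as [Pa Na], IHb as [Pb Nb]. split; intros H x [Ha|Hb].
    + left. apply Pa; [intros n Hn; apply (H n)|]; auto.
    + right. apply Pb; [intros n Hn; apply (H n)|]; auto.
    + left. apply Na; [intros n Hn; apply (H n)|]; auto.
    + right. apply Nb; [intros n Hn; apply (H n)|]; auto.
  - destruct IHa as [Pa Na], IHb as [Pb Nb].
    split; intros H x Hx (z & Hxz & Ha & Hb); apply Hx; exists z;
      (split; [exact Hxz|split]).
    + apply Na; [intros n Hn; apply (H n)|]; auto.
    + intros Hb'; apply Hb. apply Pb; [intros n Hn; apply (H n)|]; auto.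
    + apply Pa; [intros n Hn; apply (H n)|]; auto.
    + intros Hb'; apply Hb. apply Nb; [intros n Hn; apply (H n)|]; auto.
  - destruct IHa as [Pa Na].
    split; intros H x Hx (z & Hxz & Ha & _); apply Hx; exists z;
      (split; [exact Hxz|split; [|tauto]]).
    + apply Na; [intros n Hn; apply (H n)|]; auto.
    + apply Pa; [intros n Hn; apply (H n)|]; auto.
  - tauto.
  - tauto.
Qed.

(** Each [V n] is an intersection of basic clopens [sat a], stated as separation of every point
    outside it. *)
Definition closed V : Prop := forall n x, ~ V n x ->
  exists a, (forall z, V n z -> sat a z) /\ ~ sat a x.

Definition wmeet w w' : nat -> A := fun n => meet (w n) (w' n).

Lemma sub_wmeet V w w' : sub V (clopen w) -> sub V (clopen w') ->
  sub V (clopen (wmeet w w')).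
Proof. intros H H' n x Hx. apply sat_meet. split; [now apply H|now apply H']. Qed.

Lemma sub_wmeet_l w w' : sub (clopen (wmeet w w')) (clopen w).
Proof. intros n x Hx. now apply sat_meet in Hx. Qed.

Lemma sub_wmeet_r w w' : sub (clopen (wmeet w w')) (clopen w').
Proof. intros n x Hx. now apply sat_meet in Hx. Qed.

Lemma sub_one V : sub V (clopen (fun _ => one)).
Proof. intros n x _. apply sat_ge_one, leq_refl. Qed.

Lemma sub_trans V V' V'' : sub V V' -> sub V' V'' -> sub V V''.
Proof. intros H H' n x Hx. now apply H', H. Qed.

(* A point [z] above [x] violating [P0 -> N0] is obtained as a prime filter that
   contains the clopens holding on some [P w] above [x] and omits those contained
   in some [N w]. *)
Lemma up_imp_compact V (P N : (nat -> A) -> Spec A -> Prop) (P0 N0 : Spec A -> Prop) x :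
  (forall w, exists c, forall z, sat c z <-> P w z) ->
  (forall w, exists c, forall z, sat c z <-> N w z) ->
  (forall w w', sub (clopen w) (clopen w') -> forall z, P w z -> P w' z) ->
  (forall w w', sub (clopen w) (clopen w') -> forall z, N w' z -> N w z) ->
  (forall z, ~ P0 z -> exists w, sub V (clopen w) /\ ~ P w z) ->
  (forall z, N0 z -> exists w, sub V (clopen w) /\ N w z) ->
  up_imp (Spec_le A) P0 N0 x ->
  exists w, sub V (clopen w) /\ up_imp (Spec_le A) (P w) (N w) x.
Proof.
  intros HPc HNc HP HN HP0 HN0 Hx. apply NNPP; intros Hno.
  pose (G := fun c => exists w, sub V (clopen w) /\
    forall z, Spec_le A x z -> P w z -> sat c z).
  pose (J := fun c => exists w, sub V (clopen w) /\ forall z, sat c z -> N w z).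
  destruct (prime_filter_extension G J) as (Q & HQ & HQp & HGQ & HJQ).
  - split; [|split; [|split]].
    + exists (fun _ => one). split; [apply sub_one|]. intros. apply sat_ge_one, leq_refl.
    + intros a b (w & Hw & H) Hab. exists w. split; [exact Hw|].
      intros z Hxz Hz. apply sat_up with (2 := Hab). auto.
    + intros a b (w & Hw & H) (w' & Hw' & H'). exists (wmeet w w').
      split; [now apply sub_wmeet|]. intros z Hxz Hz. apply (sat_filter z).
      * apply H; [exact Hxz|]. revert Hz. apply HP, sub_wmeet_l.
      * apply H'; [exact Hxz|]. revert Hz. apply HP, sub_wmeet_r.
    + intros a (w & Hw & H). exists w. split; [exact Hw|].
      intros z Hxz Hz. apply (sat_filter z). now apply H.
  - destruct (HNc (fun _ => one)) as [c Hc]. exists c, (fun _ => one).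
    split; [apply sub_one|]. intros z. apply Hc.
  - intros i j (w & Hw & H) (w' & Hw' & H'). exists (wmeet w w').
    split; [now apply sub_wmeet|]. intros z Hz.
    apply (sat_prime z) in Hz as [Hz|Hz].
    + apply (HN _ w); [apply sub_wmeet_l|auto].
    + apply (HN _ w'); [apply sub_wmeet_r|auto].
  (* An element of both [G] and [J] would interpolate between [P] and [N] at a common refinement,
     making the implication true at [x] there, against [Hno]. *)
  - intros i (w & Hw & H) (w' & Hw' & H'). apply Hno. exists (wmeet w w').
    split; [now apply sub_wmeet|]. intros (z & Hxz & Hz & Hz'). apply Hz'.
    apply (HN _ w); [apply sub_wmeet_l|]. apply H, H'; [exact Hxz|].
    revert Hz. apply HP, sub_wmeet_r.
  - destruct (prime_filter_point Q HQ HQp) as [z Hz]. apply Hx. exists z.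
    split; [|split].
    + apply Spec_le_sat. intros a Ha. apply Hz, HGQ. exists (fun _ => one).
      split; [apply sub_one|]. intros u Hxu _. revert Ha. now apply (proj1 (Spec_le_sat x u)).
    + apply NNPP; intros HzP. destruct (HP0 z HzP) as (w & Hw & HPw).
      destruct (HPc w) as [c Hc]. apply HPw, Hc, Hz, HGQ. exists w.
      split; [exact Hw|]. intros u _. apply Hc.
    + intros HzN. destruct (HN0 z HzN) as (w & Hw & HNw).
      destruct (HNc w) as [c Hc]. apply (HJQ c).
      * exists w. split; [exact Hw|]. intros u. apply Hc.
      * now apply Hz, Hc.
Qed.

Lemma up_eval_sat f : admissible f -> forall w,
  exists c, forall z, sat c z <-> up_eval (Spec_le A) (clopen w) f z.
Proof.
  intros Hf w. exists (eval w (oneconj (phi1 top k d f))). intros z.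
  rewrite sat_oneconj. symmetry. now apply up_eval_phi1.
Qed.

(** Esakia's lemma, for both polarities at once because antecedents swap them. A refuted positive
    implication has a single witness point, where the induction hypotheses suffice; a true negative
    implication concerns all points above [x] and takes compactness. *)
Lemma up_eval_closed_approx f V : closed V -> admissible f ->
  (positive f -> forall x, ~ up_eval (Spec_le A) V f x ->
     exists w, sub V (clopen w) /\ ~ up_eval (Spec_le A) (clopen w) f x) /\
  (negative f -> forall x, up_eval (Spec_le A) V f x ->
     exists w, sub V (clopen w) /\ up_eval (Spec_le A) (clopen w) f x).
Proof.
  intros HV.
  pose proof (fun f w w' H => proj1 (up_eval_mono f (clopen w) (clopen w') H)) as Mp.
  pose proof (fun f w w' H => proj2 (up_eval_mono f (clopen w) (clopen w') H)) as Mn.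
  induction f as [n|a IHa b IHb|a IHa b IHb|a IHa b IHb|a IHa| |];
    intros Hadm; assert (Hadm' := Hadm); destruct Hadm as [Hk Hd]; simpl in Hk, Hd.
  - split.
    + intros _ x Hx. destruct (HV n x Hx) as (a & Ha & Hax).
      (* The separating element is used at [n] alone; elsewhere the value [one] holds at every point
         and so bounds any [V]. *)
      exists (fun m => if Nat.eqb m n then a else one). split.
      * intros m z Hz. unfold clopen. destruct (Nat.eqb_spec m n) as [->|_]; [auto|].
        apply sat_ge_one, leq_refl.
      * simpl. unfold clopen. now rewrite Nat.eqb_refl.
    + intros H. destruct (H n). simpl; auto.
  - assert (Ha : admissible a) by (split; tauto).
    assert (Hb : admissible b) by (split; tauto).
    destruct (IHa Ha) as [Pa Na], (IHb Hb) as [Pb Nb]. split; intros H x Hx.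
    + assert (pa : positive a) by (intros n Hn; apply (H n); simpl; auto).
      assert (pb : positive b) by (intros n Hn; apply (H n); simpl; auto).
      apply not_and_or in Hx as [Hx|Hx].
      * destruct (Pa pa x Hx) as (w & Hw & Hwx). exists w. simpl; tauto.
      * destruct (Pb pb x Hx) as (w & Hw & Hwx). exists w. simpl; tauto.
    + assert (na : negative a) by (intros n Hn; apply (H n); simpl; auto).
      assert (nb : negative b) by (intros n Hn; apply (H n); simpl; auto).
      destruct Hx as [Hxa Hxb].
      destruct (Na na x Hxa) as (w & Hw & Hwx), (Nb nb x Hxb) as (w' & Hw' & Hwx').
      exists (wmeet w w'). split; [now apply sub_wmeet|split].
      * exact (Mn a _ _ (sub_wmeet_l w w') na x Hwx).
      * exact (Mn b _ _ (sub_wmeet_r w w') nb x Hwx').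
  - assert (Ha : admissible a) by (split; tauto).
    assert (Hb : admissible b) by (split; tauto).
    destruct (IHa Ha) as [Pa Na], (IHb Hb) as [Pb Nb]. split; intros H x Hx.
    + assert (pa : positive a) by (intros n Hn; apply (H n); simpl; auto).
      assert (pb : positive b) by (intros n Hn; apply (H n); simpl; auto).
      apply not_or_and in Hx as [Hxa Hxb].
      destruct (Pa pa x Hxa) as (w & Hw & Hwx), (Pb pb x Hxb) as (w' & Hw' & Hwx').
      exists (wmeet w w'). split; [now apply sub_wmeet|]. intros [Hx|Hx].
      * apply Hwx. exact (Mp a _ _ (sub_wmeet_l w w') pa x Hx).
      * apply Hwx'. exact (Mp b _ _ (sub_wmeet_r w w') pb x Hx).
    + assert (na : negative a) by (intros n Hn; apply (H n); simpl; auto).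
      assert (nb : negative b) by (intros n Hn; apply (H n); simpl; auto).
      destruct Hx as [Hx|Hx].
      * destruct (Na na x Hx) as (w & Hw & Hwx). exists w. simpl; tauto.
      * destruct (Nb nb x Hx) as (w & Hw & Hwx). exists w. simpl; tauto.
  - assert (Ha : admissible a) by (split; tauto).
    assert (Hb : admissible b) by (split; tauto).
    destruct (IHa Ha) as [Pa Na], (IHb Hb) as [Pb Nb]. split; intros H x Hx.
    + assert (na : negative a) by (intros n Hn; apply (H n); simpl; auto).
      assert (pb : positive b) by (intros n Hn; apply (H n); simpl; auto).
      apply NNPP in Hx as (z & Hxz & Hza & Hzb).
      destruct (Na na z Hza) as (w & Hw & Hwz), (Pb pb z Hzb) as (w' & Hw' & Hwz').
      exists (wmeet w w'). split; [now apply sub_wmeet|]. intros Hx. apply Hx.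
      exists z. split; [exact Hxz|split].
      * exact (Mn a _ _ (sub_wmeet_l w w') na z Hwz).
      * intros Hz. apply Hwz'. exact (Mp b _ _ (sub_wmeet_r w w') pb z Hz).
    + assert (pa : positive a) by (intros n Hn; apply (H n); simpl; auto).
      assert (nb : negative b) by (intros n Hn; apply (H n); simpl; auto).
      apply up_imp_compact with
        (P := fun w => up_eval (Spec_le A) (clopen w) a)
        (N := fun w => up_eval (Spec_le A) (clopen w) b) (7 := Hx).
      * now apply up_eval_sat.
      * now apply up_eval_sat.
      * intros w w' Hww'. exact (Mp a w w' Hww' pa).
      * intros w w' Hww'. exact (Mn b w w' Hww' nb).
      * exact (Pa pa).
      * exact (Nb nb).
  - assert (Ha : admissible a) by (split; tauto).
    destruct (IHa Ha) as [Pa Na]. split; intros H x Hx.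
    + assert (na : negative a) by (intros n Hn; apply (H n); simpl; auto).
      apply NNPP in Hx as (z & Hxz & Hza & _).
      destruct (Na na z Hza) as (w & Hw & Hwz).
      exists w. split; [exact Hw|]. intros Hx. apply Hx. exists z. auto.
    + assert (pa : positive a) by (intros n Hn; apply (H n); simpl; auto).
      apply up_imp_compact with
        (P := fun w => up_eval (Spec_le A) (clopen w) a)
        (N := fun _ _ => False) (7 := Hx).
      * now apply up_eval_sat.
      * intros w. exists (eval w fbot). intros z. split; [|tauto].
        apply sat_bot, (Hk I).
      * intros w w' Hww'. exact (Mp a w w' Hww' pa).
      * tauto.
      * exact (Pa pa).
      * intros z [].
  - split; intros _ x Hx; [|destruct Hx].
    exists (fun _ => one). split; [apply sub_one|exact Hx].
  - split; intros _ x Hx; [destruct Hx; exact I|].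
    exists (fun _ => one). split; [apply sub_one|exact Hx].
Qed.

(** * Refutations controlled by finitely many points *)

(* All sufficiently close clopen approximations of a closed valuation below [V]
   that meets the finitely many requirements [r] satisfy [Q]; this "eventual" form
   is what makes [forced] closed under conjunction although Sahlqvist formulas are
   not monotone. *)
Definition forced V (Q : (nat -> Spec A -> Prop) -> Prop) : Prop :=
  exists r : list (nat * Spec A), (forall n z, In (n, z) r -> V n z) /\
    forall V0, closed V0 -> sub V0 V -> (forall n z, In (n, z) r -> V0 n z) ->
    exists w, sub V0 (clopen w) /\
      forall w', sub V0 (clopen w') -> sub (clopen w') (clopen w) -> Q (clopen w').

Lemma forced_weaken V (Q Q' : (nat -> Spec A -> Prop) -> Prop) :
  (forall W, Q W -> Q' W) -> forced V Q -> forced V Q'.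
Proof.
  intros HQ (r & Hr & H). exists r. split; [exact Hr|].
  intros V0 H1 H2 H3. destruct (H V0 H1 H2 H3) as (w & Hw & Hw'). exists w. auto.
Qed.

Lemma forced_and V (Q Q' : (nat -> Spec A -> Prop) -> Prop) :
  forced V Q -> forced V Q' -> forced V (fun W => Q W /\ Q' W).
Proof.
  intros (r & Hr & H) (r' & Hr' & H'). exists (r ++ r'). split.
  - intros n z Hn. apply in_app_or in Hn as []; auto.
  - intros V0 H1 H2 H3.
    destruct (H V0 H1 H2) as (w & Hw & HQ). { intros; apply H3, in_or_app; auto. }
    destruct (H' V0 H1 H2) as (w' & Hw' & HQ'). { intros; apply H3, in_or_app; auto. }
    exists (wmeet w w'). split; [now apply sub_wmeet|]. intros u Hu Huw. split.
    + apply HQ; [exact Hu|]. apply sub_trans with (1 := Huw), sub_wmeet_l.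
    + apply HQ'; [exact Hu|]. apply sub_trans with (1 := Huw), sub_wmeet_r.
Qed.

Lemma forced_true V (Q : (nat -> Spec A -> Prop) -> Prop) :
  (forall W, Q W) -> forced V Q.
Proof.
  intros HQ. exists []. split; [intros n z []|]. intros V0 _ _ _.
  exists (fun _ => one). split; [apply sub_one|auto].
Qed.

(** The list of requirements is empty: shrinking the valuation keeps a positive formula false, and
    Esakia's lemma passes from the closed valuation to a clopen one. *)
Lemma forced_positive f V x : admissible f -> positive f ->
  ~ up_eval (Spec_le A) V f x -> forced V (fun W => ~ up_eval (Spec_le A) W f x).
Proof.
  intros Hadm Hf Hx. exists []. split; [intros n z []|]. intros V0 Hcl Hsub _.
  destruct (proj1 (up_eval_closed_approx f V0 Hcl Hadm) Hf x) as (w & Hw & Hwx).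
  - intros H. apply Hx. revert H. now apply (up_eval_mono f V0 V).
  - exists w. split; [exact Hw|]. intros w' _ Hw' H. apply Hwx.
    revert H. now apply (up_eval_mono f _ _ Hw').
Qed.

Lemma forced_negative f V x : admissible f -> negative f ->
  up_eval (Spec_le A) V f x -> forced V (fun W => up_eval (Spec_le A) W f x).
Proof.
  intros Hadm Hf Hx. exists []. split; [intros n z []|]. intros V0 Hcl Hsub _.
  destruct (proj2 (up_eval_closed_approx f V0 Hcl Hadm) Hf x) as (w & Hw & Hwx).
  - revert Hx. now apply (up_eval_mono f V0 V).
  - exists w. split; [exact Hw|]. intros w' _ Hw'.
    revert Hwx. now apply (up_eval_mono f _ _ Hw').
Qed.

Lemma forced_ant f V x : admissible f -> sahl_ant f ->
  up_eval (Spec_le A) V f x -> forced V (fun W => up_eval (Spec_le A) W f x).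
Proof.
  intros Hadm Hf; revert x Hadm.
  induction Hf as [n|f Hf| | |a b _ IHa _ IHb|a b _ IHa _ IHb]; intros x Hadm Hx.
  (* True variables are the only source of requirements: once [V0] keeps [x] in the value of [n], so
     does every clopen valuation above [V0]. *)
  - exists [(n, x)]. split.
    + intros m z [E|[]]. injection E as <- <-. exact Hx.
    + intros V0 _ _ H. exists (fun _ => one). split; [apply sub_one|].
      intros w' Hw' _. apply Hw', H. now left.
  - now apply forced_negative.
  - destruct Hx.
  - apply forced_true. intros W. exact I.
  - destruct Hx, Hadm as [Hk Hd]; simpl in Hk, Hd.
    apply forced_and; [apply IHa|apply IHb]; auto; split; tauto.
  - destruct Hadm as [Hk Hd]; simpl in Hk, Hd. destruct Hx as [Hx|Hx].
    + refine (forced_weaken _ _ _ _ (IHa x _ Hx)); [now left|split; tauto].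
    + refine (forced_weaken _ _ _ _ (IHb x _ Hx)); [now right|split; tauto].
Qed.

(** The point [z] refuting an implication under [V] is retained: the antecedent is forced true and
    the consequent forced false there. *)
Lemma forced_sahl_imp f V x : admissible f -> sahl_imp f ->
  ~ up_eval (Spec_le A) V f x -> forced V (fun W => ~ up_eval (Spec_le A) W f x).
Proof.
  intros Hadm Hf. destruct Hf as [g Hg|a Ha|a b Ha Hb]; intros Hx.
  - now apply forced_positive.
  - apply NNPP in Hx as (z & Hxz & Hz & _). destruct Hadm as [Hk Hd]; simpl in Hk, Hd.
    refine (forced_weaken _ _ _ _ (forced_ant a V z _ Ha Hz)); [|split; tauto].
    intros W HW H. apply H. exists z. auto.
  - apply NNPP in Hx as (z & Hxz & Hza & Hzb).
    destruct Hadm as [Hk Hd]; simpl in Hk, Hd.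
    refine (forced_weaken _ _ _ _ (forced_and _ _ _
      (forced_ant a V z _ Ha Hza) (forced_positive b V z _ Hb Hzb))); try (split; tauto).
    intros W [HWa HWb] H. apply H. exists z. auto.
Qed.

Lemma forced_sahl_fm f V x : admissible f -> sahl_fm f ->
  ~ up_eval (Spec_le A) V f x -> forced V (fun W => ~ up_eval (Spec_le A) W f x).
Proof.
  intros Hadm Hf. induction Hf as [f Hf|a b _ IHa _ IHb|a b _ IHa _ IHb]; intros Hx.
  - now apply forced_sahl_imp.
  - destruct Hadm as [Hk Hd]; simpl in Hk, Hd. apply not_and_or in Hx as [Hx|Hx].
    + refine (forced_weaken _ _ _ _ (IHa _ Hx)); [simpl; tauto|split; tauto].
    + refine (forced_weaken _ _ _ _ (IHb _ Hx)); [simpl; tauto|split; tauto].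
  - destruct Hadm as [Hk Hd]; simpl in Hk, Hd. apply not_or_and in Hx as [Hxa Hxb].
    refine (forced_weaken _ _ _ _ (forced_and _ _ _ (IHa _ Hxa) (IHb _ Hxb)));
      [simpl; tauto|split; tauto|split; tauto].
Qed.

Lemma forced_all (phis : list sfm) V x :
  (forall f, In f phis -> admissible f /\ sahl_fm f) ->
  (forall f, In f phis -> ~ up_eval (Spec_le A) V f x) ->
  forced V (fun W => forall f, In f phis -> ~ up_eval (Spec_le A) W f x).
Proof.
  induction phis as [|g l IH]; intros Hadm Hx.
  - apply forced_true. intros W f [].
  - refine (forced_weaken _ _ _ _ (forced_and _ _ _ (forced_sahl_fm g V x _ _ _) (IH _ _))).
    + intros W [Hg Hl] f [<-|Hf]; auto.
    + apply Hadm. now left.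
    + apply Hadm. now left.
    + apply Hx. now left.
    + intros f Hf. apply Hadm. now right.
    + intros f Hf. apply Hx. now right.
Qed.

(* The empty union is closed because every point omits some element of [A]; no
   bottom element is needed. *)
Lemma finite_up_closed (r : list (nat * Spec A)) :
  closed (fun n x => exists z, In (n, z) r /\ Spec_le A z x).
Proof.
  intros n x. induction r as [|[m z] r IH]; intros Hx.
  - destruct (sat_proper x) as [a Ha]. exists a. split; [|exact Ha].
    intros u (y & [] & _).
  - destruct IH as (a & Ha & Hax).
    { intros (y & Hy & Hyx). apply Hx. exists y. simpl; auto. }
    destruct (Nat.eq_dec m n) as [->|Hmn].
    + assert (Hzx : ~ Spec_le A z x).
      { intros H. apply Hx. exists z. simpl; auto. }
      rewrite Spec_le_sat in Hzx. apply not_all_ex_not in Hzx as [b Hb].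
      apply imply_to_and in Hb as [Hbz Hbx].
      (* [b] separates [x] from the upset of [z], and [a] from the remaining ones. Cut down to below
         one, their join acts as a union, and still fails at [x]. *)
      exists (join (meet one a) (meet one b)). split.
      * intros u (y & [E|Hy] & Hyu).
        -- injection E as <-. apply sat_join_below_one; try apply meet_lel.
           right. apply sat_meet. split; [apply sat_ge_one, leq_refl|].
           revert Hbz. now apply (proj1 (Spec_le_sat z u)).
        -- apply sat_join_below_one; try apply meet_lel.
           left. apply sat_meet. split; [apply sat_ge_one, leq_refl|].
           apply Ha. now exists y.
      * intros H. apply (sat_prime x) in H. tauto.
    + exists a. split; [|exact Hax]. intros u (y & [E|Hy] & Hyu).
      * congruence.
      * apply Ha. now exists y.
Qed.

(** The upsets generated by the requirements [r] form a closed valuation, below [V] because the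
    [V n] are upsets. Its clopen approximation refutes all the formulas at [x]. *)
Lemma sahlqvist_canonicity (phis : list sfm) :
  (forall f, In f phis -> admissible f /\ sahl_fm f) ->
  (forall w x, exists f, In f phis /\ up_eval (Spec_le A) (clopen w) f x) ->
  forall V, (forall n, upset (Spec_le A) (V n)) ->
  forall x, exists f, In f phis /\ up_eval (Spec_le A) V f x.
Proof.
  intros Hphis Hcl V HV x. apply NNPP; intros Hno.
  destruct (forced_all phis V x Hphis) as (r & Hr & H).
  { intros f Hf Hx. apply Hno. now exists f. }
  destruct (H _ (finite_up_closed r)) as (w & Hw & Hw').
  - intros n z (y & Hy & Hyz). apply HV with (1 := Hyz). now apply Hr.
  - intros n z Hz. exists z. split; [exact Hz|]. intros a b Hab; exact Hab.
  - destruct (Hcl w x) as (f & Hf & Hx).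
    apply (Hw' w Hw) in Hf; [contradiction|]. intros n u Hu; exact Hu.
Qed.

End Canonicity.

Lemma up_eval_ext {X : Type} (R : X -> X -> Prop) (V V' : nat -> X -> Prop) f :
  (forall n, occurs n f -> V n = V' n) -> up_eval R V f = up_eval R V' f.
Proof.
  unfold occurs. induction f as [n|a IHa b IHb|a IHa b IHb|a IHa b IHb|a IHa| |];
    simpl; intros H; try reflexivity.
  - apply H. auto.
  - rewrite IHa, IHb; [reflexivity| |]; intros n Hn; apply H; tauto.
  - rewrite IHa, IHb; [reflexivity| |]; intros n Hn; apply H; tauto.
  - rewrite IHa, IHb; [reflexivity| |]; intros n Hn; apply H; simpl; tauto.
  - rewrite IHa; [reflexivity|]; intros n Hn; apply H; simpl; tauto.
Qed.

(** * The Lindenbaum algebra *)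

Section Lindenbaum.
Variable Ax : fm -> Prop.
Hypothesis HAx : axiomatic_ext Ax.

(** Provable equality. Finiteness of [S] matches derivability in [ILL], and two such sets can be
    pooled by concatenation. *)
Definition eqv (f g : fm) : Prop :=
  exists S : list fm, (forall h, In h S -> Ax h) /\
    forall (A : FLe) (v : nat -> A),
      (forall h, In h S -> leq one (eval v h)) -> eval v f = eval v g.

Lemma thm_eqv f : thm Ax f <-> eqv (And One f) One.
Proof.
  split; intros (S & HS & H); exists S; (split; [|exact H]).
  - intros h Hh. now destruct (HS h Hh).
  - intros h Hh. auto.
Qed.

Lemma eqv_valid f g : (forall (A : FLe) (v : nat -> A), eval v f = eval v g) -> eqv f g.
Proof. intros H. exists []. split; [intros h []|]. intros; apply H. Qed.

Lemma eqv_sym f g : eqv f g -> eqv g f.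
Proof.
  intros (S & HS & H). exists S. split; [exact HS|]. intros. symmetry; auto.
Qed.

Lemma eqv_app f g f' g' h h' :
  (forall (A : FLe) (v : nat -> A), eval v f = eval v g -> eval v f' = eval v g' ->
     eval v h = eval v h') ->
  eqv f g -> eqv f' g' -> eqv h h'.
Proof.
  intros Hh (S & HS & H) (S' & HS' & H'). exists (S ++ S'). split.
  - intros e He. apply in_app_or in He as []; auto.
  - intros A v Hv. apply Hh; [apply H|apply H']; intros; apply Hv, in_or_app; auto.
Qed.

Lemma eqv_trans f g h : eqv f g -> eqv g h -> eqv f h.
Proof. apply eqv_app. intros; congruence. Qed.

(** Closure of the axioms under substitution enters here. *)
Lemma eqv_subst s f g : eqv f g -> eqv (subst s f) (subst s g).
Proof.
  intros (S & HS & H). exists (map (subst s) S). split.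
  - intros h Hh. apply in_map_iff in Hh as (h' & <- & Hh'). auto.
  - intros A v Hv. rewrite !eval_subst. apply H. intros h Hh.
    rewrite <- eval_subst. now apply Hv, in_map.
Qed.

(** A canonical representative: the predicate [eqv f] depends only on the class of [f], so the
    choice operator picks one formula per class. *)
Definition rep (f : fm) : fm := epsilon (inhabits f) (eqv f).

Lemma rep_eqv f : eqv f (rep f).
Proof. unfold rep. apply epsilon_spec. exists f. now apply eqv_valid. Qed.

Lemma rep_eq f g : eqv f g <-> rep f = rep g.
Proof.
  split.
  - intros H. assert (E : eqv f = eqv g).
    { apply functional_extensionality; intros h. apply propositional_extensionality.
      split; intros; eauto using eqv_trans, eqv_sym. }
    unfold rep. rewrite E. f_equal. apply proof_irrelevance.
  - intros E. apply eqv_trans with (rep f); [apply rep_eqv|].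
    rewrite E. apply eqv_sym, rep_eqv.
Qed.

(** The quotient set, encoded by the fixed points of [rep]. *)
Definition lind : Type := { f : fm | rep f = f }.

Definition cls (f : fm) : lind :=
  exist _ (rep f) (proj1 (rep_eq (rep f) f) (eqv_sym _ _ (rep_eqv f))).

Lemma cls_eq f g : cls f = cls g <-> eqv f g.
Proof.
  rewrite rep_eq. split.
  - intros E. exact (f_equal (@proj1_sig _ _) E).
  - intros E. unfold cls. apply eq_sig_hprop; [intros; apply proof_irrelevance|exact E].
Qed.

Lemma cls_proj (u : lind) : cls (proj1_sig u) = u.
Proof.
  apply eq_sig_hprop; [intros; apply proof_irrelevance|]. exact (proj2_sig u).
Qed.

Definition lift2 (op : fm -> fm -> fm) (u v : lind) : lind :=
  cls (op (proj1_sig u) (proj1_sig v)).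

Lemma lift2_cls (op : fm -> fm -> fm) f g :
  (forall (A : FLe) (v : nat -> A) a b a' b', eval v a = eval v a' ->
     eval v b = eval v b' -> eval v (op a b) = eval v (op a' b')) ->
  lift2 op (cls f) (cls g) = cls (op f g).
Proof.
  intros Hop. apply cls_eq. apply eqv_sym.
  apply eqv_app with (3 := rep_eqv g) (2 := rep_eqv f). intros; now apply Hop.
Qed.

Lemma lift2_And f g : lift2 And (cls f) (cls g) = cls (And f g).
Proof. apply lift2_cls. simpl; congruence. Qed.
Lemma lift2_Or f g : lift2 Or (cls f) (cls g) = cls (Or f g).
Proof. apply lift2_cls. simpl; congruence. Qed.
Lemma lift2_Mul f g : lift2 Mul (cls f) (cls g) = cls (Mul f g).
Proof. apply lift2_cls. simpl; congruence. Qed.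
Lemma lift2_Imp f g : lift2 Imp (cls f) (cls g) = cls (Imp f g).
Proof. apply lift2_cls. simpl; congruence. Qed.

Ltac lind_classes :=
  intros;
  repeat match goal with u : lind |- _ =>
    rewrite <- (cls_proj u); generalize (proj1_sig u); clear u; intros ? end;
  rewrite ?lift2_And, ?lift2_Or, ?lift2_Mul, ?lift2_Imp;
  rewrite ?lift2_And, ?lift2_Or, ?lift2_Mul, ?lift2_Imp.

Ltac lind_identity lem :=
  lind_classes; apply cls_eq, eqv_valid; intros; apply lem.

Definition Lindenbaum : FLe.
Proof.
  refine {| car := lind; meet := lift2 And; join := lift2 Or; mul := lift2 Mul;
            imp := lift2 Imp; zero := cls Zero; one := cls One |}.
  - lind_identity meet_comm.
  - lind_identity meet_assoc.
  - lind_identity join_comm.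
  - lind_identity join_assoc.
  - lind_identity meet_absorb.
  - lind_identity join_absorb.
  - lind_identity mul_assoc.
  - lind_identity mul_comm.
  - lind_identity mul_one.
  (* Both sides are equations enforced by finitely many axioms; residuation in each algebra lets the
     same axioms serve for the other side. *)
  - lind_classes. rewrite !cls_eq.
    split; intros (S & HS & H); exists S; (split; [exact HS|]);
      intros A v Hv; apply residuation; exact (H A v Hv).
Defined.

Lemma eval_Lindenbaum (s : nat -> fm) f :
  eval (A := Lindenbaum) (fun n => cls (s n)) f = cls (subst s f).
Proof.
  induction f; simpl; try reflexivity; rewrite IHf1, IHf2.
  - apply lift2_And.
  - apply lift2_Or.
  - apply lift2_Mul.
  - apply lift2_Imp.
Qed.

Lemma subst_Var f : subst Var f = f.
Proof. induction f; simpl; congruence. Qed.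

Lemma leq_one_Lindenbaum f : leq (A := Lindenbaum) one (cls f) <-> thm Ax f.
Proof.
  rewrite thm_eqv. unfold leq; simpl. rewrite lift2_And. apply cls_eq.
Qed.

(** Every valuation is [cls] after a substitution, so a theorem takes as value the class of one of
    its substitution instances. *)
Lemma Lindenbaum_inK : inK Ax Lindenbaum.
Proof.
  intros f Hf v.
  replace v with (fun n => cls (proj1_sig (v n)))
    by (apply functional_extensionality; intros; apply cls_proj).
  rewrite eval_Lindenbaum, leq_one_Lindenbaum, thm_eqv.
  change (eqv (subst (fun n => proj1_sig (v n)) (And One f))
              (subst (fun n => proj1_sig (v n)) One)).
  now apply eqv_subst, thm_eqv.
Qed.

(** Validity is tested in the Lindenbaum algebra, with each variable sent to its own class. *)
Lemma thm_of_inK f :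
  (forall A : FLe, inK Ax A -> forall v : nat -> A, leq one (eval v f)) -> thm Ax f.
Proof.
  intros H. apply leq_one_Lindenbaum. rewrite <- (subst_Var f), <- eval_Lindenbaum.
  apply H, Lindenbaum_inK.
Qed.

End Lindenbaum.

(** * Transfer between the target formula and [tr] on spectra *)

Theorem theorem10p6
  (Ax : fm -> Prop) (HAx : axiomatic_ext Ax)
  (phis : list sfm) (y z : nat) (HPhi : sahlqvist_qe phis y z)
  (Hcomp : compatible_qe Ax phis)
  (top : fm) (Htop : thm Ax top)
  (k d : nat)
  (Hk : (exists phi, In phi phis /\ has_zero_or_neg phi) -> kcond Ax k)
  (Hd : (exists phi, In phi phis /\ has_imp phi) -> dcond Ax d)
  (tr : pfo) (Htr_sent : sentence tr)
  (Htr : forall (X : Type) (R : X -> X -> Prop), partial_order R ->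
           (up_sat_qe R phis y z <-> psat R nil tr)) :
  thm Ax (target top k d phis) <->
  (forall A : FLe, inK Ax A -> psat (Spec_le A) nil tr).
Proof.
  destruct HPhi as (Hne & Hyz & Hphis).
  assert (Hadm : forall f, In f phis -> admissible Ax k d f).
  { intros f Hf. split; intros H; [apply Hk|apply Hd]; eauto. }
  split.
  - intros Hthm A HA. apply Htr; [apply Spec_le_partial_order|].
    intros V HV Hqe x. split; [tauto|]. intros Hy. split; [exact Hy|].
    (* By canonicity some formula of the list holds at [x]; its premise then carries [x] from [V y]
       to [V z]. *)
    destruct (sahlqvist_canonicity Ax top k d Htop A HA phis) with (3 := HV) (x := x)
      as (f & Hf & Hx).
    + intros f Hf. split; [auto|]. now apply Hphis.
    + intros w u. apply (sat_target Ax top k d Htop A HA phis w u Hne Hadm).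
      apply sat_ge_one. now apply HA.
    + apply (Hqe f Hf x). auto.
  - intros Hpsat. apply thm_of_inK; [exact HAx|]. intros A HA w.
    apply leq_one_of_sat. intros x.
    apply (sat_target Ax top k d Htop A HA phis w x Hne Hadm).
    assert (Hqe := proj2 (Htr _ _ Spec_le_partial_order) (Hpsat A HA)).
    (* The quasiequation is instantiated with [y] as the whole space and [z] as the union [U] of the
       values of the formulas. All premises then hold, and the conclusion says that [U] is
       everything. *)
    set (U := fun u => exists f, In f phis /\ up_eval (Spec_le A) (clopen A w) f u).
    pose (V := fun n => if Nat.eqb n y then (fun _ => True)
                        else if Nat.eqb n z then U else clopen A w n).
    assert (HVy : V y = fun _ => True) by (unfold V; now rewrite Nat.eqb_refl).
    assert (HVz : V z = U).
    { unfold V. rewrite Nat.eqb_refl.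
      destruct (Nat.eqb_spec z y) as [->|_]; [now destruct Hyz|reflexivity]. }
    assert (HVw : forall f, In f phis ->
      up_eval (Spec_le A) V f = up_eval (Spec_le A) (clopen A w) f).
    { intros f Hf. destruct (Hphis f Hf) as (_ & Hfy & Hfz).
      apply up_eval_ext. intros n Hn. unfold V.
      destruct (Nat.eqb_spec n y) as [->|_]; [contradiction|].
      destruct (Nat.eqb_spec n z) as [->|_]; [contradiction|reflexivity]. }
    assert (Hsat : forall a, upset (Spec_le A) (sat a)).
    { intros a u u' Huu'. now apply (proj1 (Spec_le_sat u u') Huu'). }
    enough (HU : up_le (V y) (V z)).
    { destruct (HU x) as [_ HUx]. rewrite HVy, HVz in HUx. exact (proj2 (HUx I)). }
    apply Hqe.
    + intros n. unfold V. destruct (Nat.eqb n y); [intros u u'; auto|].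
      destruct (Nat.eqb n z); [|apply Hsat].
      (* Under a clopen valuation each formula takes a clopen value, hence an upset. *)
      intros u u' Huu' (f & Hf & Hu). exists f. split; [exact Hf|].
      destruct (up_eval_sat Ax top k d Htop A HA f (Hadm f Hf) w) as [c Hc].
      apply Hc, (Hsat c u u' Huu'), Hc, Hu.
    + intros f Hf u. rewrite HVy, HVz, (HVw f Hf). split; [tauto|].
      intros [Hu _]. repeat split; auto. now exists f.
Qed.
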